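(* Let $d\ge1$. For any classical knot $K$ and any $\mu^0\in\operatorname{Comp}^0_d$, $$\Gamma^\gamma_{Y,\mu^0}(K)=\begin{cases}\Gamma_{\mathcal H}(K)&\text{if }|\mu^0|=1,\\ 0&\text{otherwise.}\end{cases}$$ In particular, for classical knots, the invariants obtained from $Y_{d,n}$ are topologically equivalent to the HOMFLYPT polynomial: for any two classical knots $K_1,K_2$, one has $\Gamma^\gamma_{Y,\mu^0}(K_1)=\Gamma^\gamma_{Y,\mu^0}(K_2)$ for all $\mu^0\in\operatorname{Comp}^0_d$ if and only if $\Gamma_{\mathcal H}(K_1)=\Gamma_{\mathcal H}(K_2)$.
   Context: Let $u,v,\gamma$ be indeterminates, $B=\mathbb C[u^{\pm1},v^{\pm1}]$, $R=\mathbb C[u^{\pm1},v^{\pm1},\gamma^{\pm1}]$, and let $\xi_1,\dots,\xi_d$ be the $d$-th roots of unity in $\mathbb C$. Hecke algebra: $\mathcal H_n$ ($n\ge1$) is the unital $B$-algebra with generators $T_1,\dots,T_{n-1}$ and relations $T_iT_j=T_jT_i$ ($|i-j|>1$), $T_iT_{i+1}T_i=T_{i+1}T_iT_{i+1}$, $T_i^2=u^2+vT_i$; $\mathcal H_0=B$; $\mathcal H_n\subset\mathcal H_{n+1}$ naturally. $\{\tau_n:\mathcal H_n\to B\}_{n\ge1}$ is the unique family of $B$-linear maps with $\tau_1(1)=1$, $\tau_n(xy)=\tau_n(yx)$, $\tau_{n+1}(xT_n)=\tau_{n+1}(xT_n^{-1})=\tau_n(x)$ for $x,y\in\mathcal H_n$;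 $\tau_0=\mathrm{id}_B$. Permutations are multiplied as functions, $s_i=(i,i+1)$; for $w=s_{i_1}\cdots s_{i_r}$ reduced, $\tilde T_w=u^{-r}T_{i_1}\cdots T_{i_r}$. Yokonuma--Hecke algebra: $Y_{d,n}$ is the unital $B$-algebra with generators $g_1,\dots,g_{n-1},t_1,\dots,t_n$ and relations $g_ig_j=g_jg_i$ ($|i-j|>1$), $g_ig_{i+1}g_i=g_{i+1}g_ig_{i+1}$, $t_it_j=t_jt_i$, $g_it_j=t_{s_i(j)}g_i$, $t_j^d=1$, $g_i^2=u^2+v\,e_ig_i$, with $e_i=\frac1d\sum_{s=0}^{d-1}t_i^st_{i+1}^{-s}$; $RY_{d,n}=R\otimes_BY_{d,n}$. For $w=s_{i_1}\cdots s_{i_r}$ reduced, $\tilde g_w=u^{-r}g_{i_1}\cdots g_{i_r}$. Compositions: $\operatorname{Comp}_d(n)$ is the set of $d$-tuples of non-negative integers with sum $n$; $|\mu|$ is the sum of the parts of $\mu$; $[\mu]_a=1$ if $\mu_a\ge1$ and $0$ otherwise; $\operatorname{Comp}^0_d$ is the set of non-zero $d$-tuples with entries in $\{0,1\}$. $\mathfrak S^\mu\subset\mathfrak S_n$ is the Young subgroup acting on consecutive blocks of sizes $\mu_1,\dots,\mu_d$; $\mathcal H^\mu\subset\mathcal H_n$ is the subalgebra generated by the $T_i$ with $s_i\in\mathfrak S^\mu$, identified with $\mathcal H_{\mu_1}\otimes\dots\otimes\mathcal H_{\mu_d}$; $m_\mu=n!/(\mu_1!\cdots\mu_d!)$. Characters: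 for a character $\chi$ of $(\mathbb Z/d\mathbb Z)^n=\langle t_1,\dots,t_n\rangle$, $E_\chi=\prod_{i=1}^n\bigl(\frac1d\sum_{s=0}^{d-1}\chi(t_i)^st_i^{-s}\bigr)$; $w(\chi)(t_i)=\chi(t_{w^{-1}(i)})$ for $w\in\mathfrak S_n$; $\operatorname{Comp}(\chi)=\mu$ with $\mu_a=\#\{j:\chi(t_j)=\xi_a\}$; $E_\mu=\sum_{\operatorname{Comp}(\chi)=\mu}E_\chi$. $\chi_1^\mu$ takes value $\xi_1$ on the first $\mu_1$ of the $t_j$'s, $\xi_2$ on the next $\mu_2$, etc.; $\pi_{1,\mu}=1,\dots,\pi_{m_\mu,\mu}$ are the minimal length representatives of $\mathfrak S_n/\mathfrak S^\mu$; $\chi_k^\mu=\pi_{k,\mu}(\chi_1^\mu)$. $\Psi_\mu:E_\mu Y_{d,n}\to\operatorname{Mat}_{m_\mu}(\mathcal H^\mu)$ is the algebra isomorphism given on the basis $\{E_{\chi_k^\mu}\tilde g_w\}$ by $\Psi_\mu(E_{\chi_k^\mu}\tilde g_w)=\tilde T_{\pi_{k,\mu}^{-1}w\pi_{j,\mu}}\mathrm M_{k,j}$, where $w(\chi_j^\mu)=\chi_k^\mu$ and $\mathrm M_{k,j}$ is the elementary matrix. Basic Markov traces: for $\mu^0\in\operatorname{Comp}^0_d$, $\rho_{\mu^0,n}(x)=\sum_{\mu\in\operatorname{Comp}_d(n),\,[\mu]=\mu^0}(\tau_{\mu_1}\otimes\dots\otimes\tau_{\mu_d})\circ\operatorname{Tr}_{\operatorname{Mat}_{m_\mu}}\circ\Psi_\mu(E_\mu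 x)$, where $\operatorname{Tr}_{\operatorname{Mat}_{m_\mu}}$ is the sum of diagonal entries; these are extended $R$-linearly to $RY_{d,n}$. Invariants: $B_n$ is the braid group with standard generators $\sigma_1,\dots,\sigma_{n-1}$. For a classical (oriented) link $K$ let $\beta_K\in B_n$ be a braid with closure $K$; a knot is a link with one component. Let $\delta^\gamma_{Y,n}:R[B_n]\to RY_{d,n}$ be the algebra homomorphism $\sigma_i\mapsto(\gamma+(1-\gamma)e_i)g_i$ and $\delta_{\mathcal H,n}:B[B_n]\to\mathcal H_n$ the algebra homomorphism $\sigma_i\mapsto T_i$. Then $\Gamma^\gamma_{Y,\mu^0}(K)=\rho_{\mu^0,n}\circ\delta^\gamma_{Y,n}(\beta_K)$, and the HOMFLYPT polynomial is $\Gamma_{\mathcal H}(K)=\tau_n\circ\delta_{\mathcal H,n}(\beta_K)$. These are isotopy invariants (independent of the choice of $\beta_K$). All invariants for classical links obtained from $Y_{d,n}$ by this construction (from Markov traces) are linear combinations of the $\Gamma^\gamma_{Y,\mu^0}$. *)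

(* Defs.v *)
From HB Require Import structures.
From mathcomp Require Import all_boot all_order all_algebra all_fingroup.
From mathcomp Require Import finmap generic_quotient.
From mathcomp Require Import all_classical all_reals all_analysis.
From mathcomp Require Import complex.
From mathcomp Require Import zify.
Set Implicit Arguments.
Unset Strict Implicit.
Unset Printing Implicit Defensive.
Import Order.TTheory GRing.Theory Num.Theory numFieldNormedType.Exports.
Local Open Scope fset_scope.
Local Open Scope ring_scope.

(* Laurent polynomials A[X, X^-1] with X central, A possibly non-commutative:
   finitely supported families of coefficients with the convolution product. *)
Definition laurent (A : pzRingType) : Type := {fsfun int -> A with 0}.

Section Laurent.
Variable A : pzRingType.
Implicit Types f g h : laurent A.

HB.instance Definition _ := Choice.on (laurent A).

Definition lcoef f (k : int) : A := (f : {fsfun int -> A with 0}) k.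
Definition lsupp f : {fset int} := finsupp (f : {fsfun int -> A with 0}).

(* a * X ^ k *)
Definition lmono (k : int) (a : A) : laurent A := [fsfun i in [fset k] => a].
Definition lzero : laurent A := [fsfun].
Definition lopp f : laurent A := [fsfun k in lsupp f => - lcoef f k].
Definition ladd f g : laurent A :=
  [fsfun k in lsupp f `|` lsupp g => lcoef f k + lcoef g k].
Definition lmul f g : laurent A :=
  [fsfun k in [fset i + j | i in lsupp f, j in lsupp g] =>
     \sum_(i <- lsupp f) lcoef f i * lcoef g (k - i)].

Lemma laurentP f g : lcoef f =1 lcoef g -> f = g.
Proof. by move=> h; apply/fsfunP. Qed.

Lemma lcoef_out f k : k \notin lsupp f -> lcoef f k = 0.
Proof. exact: fsfun_dflt. Qed.

Lemma lcoef_mono k a i : lcoef (lmono k a) i = if i == k then a else 0.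
Proof. by rewrite /lcoef fsfunE inE. Qed.

Lemma lcoef0 k : lcoef lzero k = 0.
Proof. by rewrite /lcoef fsfunE. Qed.

Lemma lcoefN f k : lcoef (lopp f) k = - lcoef f k.
Proof.
by rewrite /lcoef fsfunE; case: finsuppP => // _; rewrite oppr0.
Qed.

Lemma lcoefD f g k : lcoef (ladd f g) k = lcoef f k + lcoef g k.
Proof.
rewrite /lcoef fsfunE inE; case: ifPn => // /norP[kf kg].
by rewrite [in RHS]fsfun_dflt // [in RHS]fsfun_dflt // addr0.
Qed.

Lemma lcoefMw (S : {fset int}) f g k : lsupp f `<=` S ->
  lcoef (lmul f g) k = \sum_(i <- S) lcoef f i * lcoef g (k - i).
Proof.
move=> sS; rewrite -(big_fset_incl _ sS); last first.
  by move=> i _ /lcoef_out ->; rewrite mul0r.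
rewrite /lcoef fsfunE; case: ifPn => // kN.
rewrite big_seq big1 // => i iS.
have [kg|kg] := boolP (k - i \in lsupp g).
  case/negP: kN; apply/imfset2P; exists i => //=; exists (k - i) => //.
  by rewrite addrC subrK.
by rewrite [X in _ * X](@lcoef_out g) // mulr0.
Qed.
Lemma lcoefM f g k :
  lcoef (lmul f g) k = \sum_(i <- lsupp f) lcoef f i * lcoef g (k - i).
Proof. exact: lcoefMw. Qed.

Fact laddA : associative ladd.
Proof. by move=> f g h; apply: laurentP => k; rewrite !lcoefD addrA. Qed.
Fact laddC : commutative ladd.
Proof. by move=> f g; apply: laurentP => k; rewrite !lcoefD addrC. Qed.
Fact ladd0 : left_id lzero ladd.
Proof. by move=> f; apply: laurentP => k; rewrite lcoefD lcoef0 add0r. Qed.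
Fact laddN : left_inverse lzero lopp ladd.
Proof.
by move=> f; apply: laurentP => k; rewrite lcoefD lcoefN lcoef0 addNr.
Qed.

Lemma lcoef_monoM k a f i : lcoef (lmul (lmono k a) f) i = a * lcoef f (i - k).
Proof.
have s : lsupp (lmono k a) `<=` [fset k].
  apply/fsubsetP => j; rewrite mem_finsupp -/(lcoef _ _) lcoef_mono inE.
  by case: (j == k) => //; rewrite eqxx.
by rewrite (lcoefMw _ _ s) big_seq_fset1 lcoef_mono eqxx.
Qed.

Lemma lcoef_Mmono k a f i : lcoef (lmul f (lmono k a)) i = lcoef f (i - k) * a.
Proof.
have [kf|kf] := boolP (i - k \in lsupp f); last first.
  rewrite (lcoef_out kf) mul0r lcoefM big_seq big1 // => j jf.
  rewrite lcoef_mono; case: eqP => [e|]; last by rewrite mulr0.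
  by case/negP: kf; rewrite -e opprB addrC subrK.
rewrite lcoefM (big_fsetD1 (i - k)) //= lcoef_mono.
have -> : i - (i - k) = k by rewrite opprB addrC subrK.
rewrite eqxx big_seq big1 ?addr0 // => j; rewrite !inE => /andP[jk _].
rewrite lcoef_mono; case: eqP => [e|]; last by rewrite mulr0.
by case/eqP: jk; rewrite -e opprB addrC subrK.
Qed.

Fact lmulA : associative lmul.
Proof.
move=> f g h; apply: laurentP => k.
set S := [fset i + j | i in lsupp f, j in lsupp g].
have sS : lsupp (lmul f g) `<=` S.
  apply/fsubsetP => i; rewrite mem_finsupp fsfunE.
  by case: ifP => //; rewrite eqxx.
rewrite (lcoefMw _ _ sS) lcoefM.
under [RHS]eq_bigr do rewrite lcoefM mulr_suml.
rewrite exchange_big /= big_seq [RHS]big_seq; apply: eq_bigr => i iF.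
rewrite lcoefM mulr_sumr.
have sub : [fset i + j | j in lsupp g] `<=` S.
  apply/fsubsetP => x /imfsetP[j /= jg ->].
  by apply/imfset2P; exists i => //; exists j.
rewrite -(big_fset_incl _ sub) /=; last first.
  move=> x _ xN; rewrite (@lcoef_out g) ?mulr0 ?mul0r //.
  apply: contra xN => xg; apply/imfsetP; exists (x - i) => //.
  by rewrite addrC subrK.
rewrite big_imfset /=; last by move=> x y _ _; apply: addrI.
apply: eq_bigr => j _; have -> : i + j - i = j by rewrite addrC addKr.
by rewrite mulrA opprD addrA.
Qed.
Fact lmul1 : left_id (lmono 0 1) lmul.
Proof. by move=> f; apply: laurentP => k; rewrite lcoef_monoM mul1r subr0. Qed.
Fact lmulr1 : right_id (lmono 0 1) lmul.
Proof. by move=> f; apply: laurentP => k; rewrite lcoef_Mmono mulr1 subr0. Qed.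
Fact lmulDl : left_distributive lmul ladd.
Proof.
move=> f g h; apply: laurentP => k; rewrite lcoefD.
rewrite (lcoefMw _ _ (fsubsetUl (lsupp f) (lsupp g))).
rewrite (lcoefMw _ _ (fsubsetUr (lsupp f) (lsupp g))).
rewrite (@lcoefMw (lsupp f `|` lsupp g)).
  by rewrite -big_split /=; apply: eq_bigr => i _; rewrite lcoefD mulrDl.
apply/fsubsetP => i; rewrite mem_finsupp fsfunE.
by case: ifP => //; rewrite eqxx.
Qed.
Fact lmulDr : right_distributive lmul ladd.
Proof.
move=> f g h; apply: laurentP => k; rewrite lcoefD !lcoefM -big_split /=.
by apply: eq_bigr => i _; rewrite lcoefD mulrDr.
Qed.

HB.instance Definition _ := GRing.isPzRing.Build (laurent A)
  laddA laddC ladd0 laddN lmulA lmul1 lmulr1 lmulDl lmulDr.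

End Laurent.

Section LaurentCom.
Variable A : comPzRingType.
Fact lmulC : commutative (@lmul A).
Proof.
move=> f g; apply: laurentP => k; rewrite lcoefM.
have inj : injective (fun i : int => k - i) by move=> x y /addrI /oppr_inj.
set T := lsupp f `|` [fset k - i | i in lsupp g].
rewrite (@big_fset_incl _ _ _ _ _ T) ?fsubsetUl //; last first.
  by move=> i _ /lcoef_out ->; rewrite mul0r.
rewrite lcoefM.
transitivity (\sum_(i <- [fset k - i | i in lsupp g]) lcoef f i * lcoef g (k - i)).
  apply/esym/big_fset_incl; first exact: fsubsetUr.
  move=> i _ iN; rewrite [X in _ * X]lcoef_out ?mulr0 //.
  apply: contra iN => h; apply/imfsetP; exists (k - i) => //=.
  by rewrite opprB addrC subrK.
rewrite big_imfset /=; last by move=> x y _ _; apply: inj.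
by apply: eq_bigr => i _; rewrite mulrC opprB (addrC k) subrK.
Qed.
HB.instance Definition _ :=
  GRing.PzRing_hasCommutativeMul.Build (laurent A) lmulC.
End LaurentCom.

Declare Scope pterm_scope.
Delimit Scope pterm_scope with pterm.

(* The unital A-algebra presented by generators (indexed by I) and relations rel:
   algebraic expressions modulo the congruence generated by the axioms of
   unital A-algebras and by rel. *)
Inductive pterm (A I : Type) : Type :=
  | Const of A
  | Gen of I
  | Add of pterm A I & pterm A I
  | Mul of pterm A I & pterm A I.
Arguments Const {A I} _.
Arguments Gen {A I} _.
Arguments Add {A I} _ _.
Arguments Mul {A I} _ _.
Bind Scope pterm_scope with pterm.
Notation "x + y" := (Add x y) : pterm_scope.
Notation "x * y" := (Mul x y) : pterm_scope.

HB.instance Definition _ A I := gen_eqMixin (pterm A I).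
HB.instance Definition _ A I := gen_choiceMixin (pterm A I).

Section Presentation.
Variables (A : comPzRingType) (I : Type).
Local Notation pterm := (pterm A I).

Variable rel : pterm -> pterm -> Prop.

Local Open Scope pterm_scope.

Inductive cong : pterm -> pterm -> Prop :=
  | cong_rel x y : rel x y -> cong x y
  | cong_refl x : cong x x
  | cong_sym x y : cong x y -> cong y x
  | cong_trans x y z : cong x y -> cong y z -> cong x z
  | cong_Add x x' y y' : cong x x' -> cong y y' -> cong (x + y) (x' + y')
  | cong_Mul x x' y y' : cong x x' -> cong y y' -> cong (x * y) (x' * y')
  | cong_ConstD a b : cong (Const (a + b)%R) (Const a + Const b)
  | cong_ConstM a b : cong (Const (a * b)%R) (Const a * Const b)
  | cong_AddA x y z : cong (x + (y + z)) (x + y + z)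
  | cong_AddC x y : cong (x + y) (y + x)
  | cong_Add0 x : cong (Const 0%R + x) x
  | cong_AddN x : cong (Const (- 1)%R * x + x) (Const 0%R)
  | cong_MulA x y z : cong (x * (y * z)) (x * y * z)
  | cong_Mul1l x : cong (Const 1%R * x) x
  | cong_Mul1r x : cong (x * Const 1%R) x
  | cong_MulDl x y z : cong ((x + y) * z) (x * z + y * z)
  | cong_MulDr x y z : cong (x * (y + z)) (x * y + x * z)
  | cong_Central a x : cong (Const a * x) (x * Const a).

Local Close Scope pterm_scope.


Definition congb (x y : pterm) : bool := `[< cong x y >].

Fact congb_refl : reflexive congb.
Proof. by move=> x; apply/asboolP; exact: cong_refl. Qed.
Fact congb_sym : symmetric congb.
Proof. by move=> x y; apply/asboolP/asboolP; apply: cong_sym. Qed.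
Fact congb_trans : transitive congb.
Proof.
by move=> y x z /asboolP xy /asboolP yz; apply/asboolP/(cong_trans xy yz).
Qed.
Canonical congb_equiv := EquivRel congb congb_refl congb_sym congb_trans.

Definition presented : Type := {eq_quot congb_equiv}%qT.
HB.instance Definition _ := Choice.on presented.
HB.instance Definition _ := EqQuotient.on presented.

Definition pcls (x : pterm) : presented := \pi_presented%qT x.
Definition prep (x : presented) : pterm := repr x.

Lemma prepK x : pcls (prep x) = x. Proof. exact: reprK. Qed.
Lemma pclsP x y : pcls x = pcls y <-> cong x y.
Proof.
split=> [/eqP|h]; first by rewrite eqmodE => /asboolP.
by apply/eqP; rewrite eqmodE; apply/asboolP.
Qed.
Lemma prep_cong x : cong (prep (pcls x)) x.
Proof. by apply/pclsP; rewrite prepK. Qed.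

Definition pconst (a : A) : presented := pcls (Const a).
Definition pgen (i : I) : presented := pcls (Gen i).
Definition padd (x y : presented) := pcls (Add (prep x) (prep y)).
Definition pmul (x y : presented) := pcls (Mul (prep x) (prep y)).
Definition popp (x : presented) := pmul (pconst (- 1)) x.

Lemma pcls_add x y : padd (pcls x) (pcls y) = pcls (Add x y).
Proof. by apply/pclsP/cong_Add; exact: prep_cong. Qed.
Lemma pcls_mul x y : pmul (pcls x) (pcls y) = pcls (Mul x y).
Proof. by apply/pclsP/cong_Mul; exact: prep_cong. Qed.

Fact paddA : associative padd.
Proof.
move=> x y z; rewrite -[x]prepK -[y]prepK -[z]prepK !pcls_add.
exact/pclsP/cong_AddA.
Qed.
Fact paddC : commutative padd.
Proof.
by move=> x y; rewrite -[x]prepK -[y]prepK !pcls_add; exact/pclsP/cong_AddC.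
Qed.
Fact padd0 : left_id (pconst 0) padd.
Proof. by move=> x; rewrite -[x]prepK pcls_add; exact/pclsP/cong_Add0. Qed.
Fact paddN : left_inverse (pconst 0) popp padd.
Proof.
by move=> x; rewrite -[x]prepK /popp pcls_mul pcls_add; exact/pclsP/cong_AddN.
Qed.
Fact pmulA : associative pmul.
Proof.
move=> x y z; rewrite -[x]prepK -[y]prepK -[z]prepK !pcls_mul.
exact/pclsP/cong_MulA.
Qed.
Fact pmul1 : left_id (pconst 1) pmul.
Proof. by move=> x; rewrite -[x]prepK pcls_mul; exact/pclsP/cong_Mul1l. Qed.
Fact pmulr1 : right_id (pconst 1) pmul.
Proof. by move=> x; rewrite -[x]prepK pcls_mul; exact/pclsP/cong_Mul1r. Qed.
Fact pmulDl : left_distributive pmul padd.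
Proof.
move=> x y z; rewrite -[x]prepK -[y]prepK -[z]prepK !(pcls_add, pcls_mul).
exact/pclsP/cong_MulDl.
Qed.
Fact pmulDr : right_distributive pmul padd.
Proof.
move=> x y z; rewrite -[x]prepK -[y]prepK -[z]prepK !(pcls_add, pcls_mul).
exact/pclsP/cong_MulDr.
Qed.
HB.instance Definition _ := GRing.isPzRing.Build presented
  paddA paddC padd0 paddN pmulA pmul1 pmulr1 pmulDl pmulDr.

Lemma pconstM a b : pconst (a * b) = pconst a * pconst b.
Proof. by rewrite [RHS]pcls_mul; exact/pclsP/cong_ConstM. Qed.
Lemma pconstD a b : pconst (a + b) = pconst a + pconst b.
Proof. by rewrite [RHS]pcls_add; exact/pclsP/cong_ConstD. Qed.
Lemma pconst_comm a x : pconst a * x = x * pconst a.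
Proof.
rewrite -[x]prepK [LHS]pcls_mul [RHS]pcls_mul; exact/pclsP/cong_Central.
Qed.

Definition pscale (a : A) (x : presented) : presented := pconst a * x.
Fact pscaleA a b x : pscale a (pscale b x) = pscale (a * b) x.
Proof. by rewrite /pscale pconstM mulrA. Qed.
Fact pscale1 : left_id 1 pscale.
Proof. by move=> x; rewrite /pscale (mul1r x). Qed.
Fact pscaleDr : right_distributive pscale +%R.
Proof. by move=> a x y; rewrite /pscale mulrDr. Qed.
Fact pscaleDl x : {morph pscale^~ x : a b / a + b}.
Proof. by move=> a b; rewrite /pscale pconstD mulrDl. Qed.
HB.instance Definition _ := GRing.Zmodule_isLmodule.Build A presented
  pscaleA pscale1 pscaleDr pscaleDl.

Lemma pscaleAl a (x y : presented) : a *: (x * y) = (a *: x) * y.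
Proof. exact: mulrA. Qed.
Lemma pscaleAr a (x y : presented) : a *: (x * y) = x * (a *: y).
Proof. by rewrite [LHS]mulrA pconst_comm -mulrA. Qed.

(* The universal property, for a target D with central structure map c. *)
Section Lift.
Variables (D : pzRingType) (c : A -> D) (phi : I -> D).

Fixpoint teval (x : pterm) : D :=
  match x with
  | Const a => c a
  | Gen i => phi i
  | Add x y => teval x + teval y
  | Mul x y => teval x * teval y
  end.

Definition plift (x : presented) : D := teval (prep x).

Hypotheses (cD : {morph c : a b / a + b}) (cM : {morph c : a b / a * b}).
Hypothesis c1 : c 1 = 1.
Hypothesis c_central : forall a y, c a * y = y * c a.
Hypothesis phi_rel : forall x y, rel x y -> teval x = teval y.

Lemma teval_cong x y : cong x y -> teval x = teval y.
Proof.
have c0 : c 0 = 0 by apply: (addrI (c 0)); rewrite -cD !addr0.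
have cN1 : c (-1) = -1.
  by apply: (addrI (c 1)); rewrite -cD subrr c0 c1 subrr.
elim=> //= {x y}.
- by move=> x y z _ -> _ ->.
- by move=> x x' y y' _ -> _ ->.
- by move=> x x' y y' _ -> _ ->.
- by move=> x y z; rewrite addrA.
- by move=> x y; rewrite addrC.
- by move=> x; rewrite c0 add0r.
- by move=> x; rewrite c0 cN1 mulN1r addNr.
- by move=> x y z; rewrite mulrA.
- by move=> x; rewrite c1 mul1r.
- by move=> x; rewrite c1 mulr1.
- by move=> x y z; rewrite mulrDl.
- by move=> x y z; rewrite mulrDr.
Qed.

Lemma plift_cls x : plift (pcls x) = teval x.
Proof. exact/teval_cong/prep_cong. Qed.
Lemma plift_gen i : plift (pgen i) = phi i.
Proof. exact: plift_cls. Qed.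
Lemma plift_const a : plift (pconst a) = c a.
Proof. exact: plift_cls. Qed.
Lemma pliftD : {morph plift : x y / x + y}.
Proof. by move=> x y; rewrite -[LHS]/(plift (pcls _)) plift_cls. Qed.
Lemma pliftM : {morph plift : x y / x * y}.
Proof. by move=> x y; rewrite -[LHS]/(plift (pcls _)) plift_cls. Qed.
End Lift.

End Presentation.

Section Symmetric.
Variable n : nat.

Fact slo_subproof (i : 'I_n.-1) : (i < n)%N.
Proof. exact: leq_trans (ltn_ord i) (leq_pred n). Qed.
Fact shi_subproof (i : 'I_n.-1) : (i.+1 < n)%N.
Proof. by rewrite -ltn_predRL. Qed.
(* The index set 'I_n.-1 of the generators starts at 0: i : 'I_n.-1 stands for
   the generator with 1-based index i + 1, and sgen i exchanges i and i + 1. *)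
Definition slo (i : 'I_n.-1) : 'I_n := Ordinal (slo_subproof i).
Definition shi (i : 'I_n.-1) : 'I_n := Ordinal (shi_subproof i).
Definition sgen (i : 'I_n.-1) : 'S_n := tperm (slo i) (shi i).

(* Permutations multiplied as functions, whereas (p * q)%g applies p first. *)
Definition pcomp (p q : 'S_n) : 'S_n := (q * p)%g.
Lemma pcompE p q j : pcomp p q j = p (q j).
Proof. exact: permM. Qed.

Definition sword (r : seq 'I_n.-1) : 'S_n :=
  foldr (fun i p => pcomp (sgen i) p) 1%g r.
Definition reduced (r : seq 'I_n.-1) : Prop :=
  forall r', sword r' = sword r -> (size r <= size r')%N.
Definition redexpr (w : 'S_n) : seq 'I_n.-1 :=
  xget [::] [set r | sword r = w /\ reduced r]%classic.
Definition plength (w : 'S_n) : nat := size (redexpr w).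

Definition far (i j : 'I_n.-1) : bool := ((i.+1 < j) || (j.+1 < i))%N.
Definition adjacent (i j : 'I_n.-1) : bool := j == i.+1 :> nat.
End Symmetric.

Section Braid.
Variable n : nat.

(* (i, true) is sigma_i and (i, false) is its inverse. *)
Definition letter : Type := ('I_n.-1 * bool)%type.

Inductive braid_cong : seq letter -> seq letter -> Prop :=
  | bc_refl w : braid_cong w w
  | bc_sym w w' : braid_cong w w' -> braid_cong w' w
  | bc_trans w w' w'' :
      braid_cong w w' -> braid_cong w' w'' -> braid_cong w w''
  | bc_cat w1 w1' w2 w2' : braid_cong w1 w1' -> braid_cong w2 w2' ->
      braid_cong (w1 ++ w2) (w1' ++ w2')
  | bc_cancel i b : braid_cong [:: (i, b); (i, ~~ b)] [::]
  | bc_far i j : far i j ->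
      braid_cong [:: (i, true); (j, true)] [:: (j, true); (i, true)]
  | bc_braid i j : adjacent i j ->
      braid_cong [:: (i, true); (j, true); (i, true)]
                 [:: (j, true); (i, true); (j, true)].

Definition bcongb (w w' : seq letter) : bool := `[< braid_cong w w' >].
Fact bcongb_refl : reflexive bcongb.
Proof. by move=> x; apply/asboolP; exact: bc_refl. Qed.
Fact bcongb_sym : symmetric bcongb.
Proof. by move=> x y; apply/asboolP/asboolP; apply: bc_sym. Qed.
Fact bcongb_trans : transitive bcongb.
Proof.
by move=> y x z /asboolP xy /asboolP yz; apply/asboolP/(bc_trans xy yz).
Qed.
Canonical bcongb_equiv := EquivRel bcongb bcongb_refl bcongb_sym bcongb_trans.

Definition braid : Type := {eq_quot bcongb_equiv}%qT.
HB.instance Definition _ := Choice.on braid.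
HB.instance Definition _ := EqQuotient.on braid.

Definition braid_of (w : seq letter) : braid := \pi_braid%qT w.
Definition brep (b : braid) : seq letter := repr b.

Lemma brepK b : braid_of (brep b) = b. Proof. exact: reprK. Qed.
Lemma braid_ofP w w' : braid_of w = braid_of w' <-> braid_cong w w'.
Proof.
split=> [/eqP|h]; first by rewrite eqmodE => /asboolP.
by apply/eqP; rewrite eqmodE; apply/asboolP.
Qed.
Lemma brep_cong w : braid_cong (brep (braid_of w)) w.
Proof. by apply/braid_ofP; rewrite brepK. Qed.

Definition winv (w : seq letter) : seq letter :=
  rev [seq (l.1, ~~ l.2) | l <- w].

Definition bone : braid := braid_of [::].
Definition bmul (a b : braid) : braid := braid_of (brep a ++ brep b).
Definition binv (a : braid) : braid := braid_of (winv (brep a)).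

Lemma bmul_of w w' : bmul (braid_of w) (braid_of w') = braid_of (w ++ w').
Proof. by apply/braid_ofP/bc_cat; exact: brep_cong. Qed.
Fact bmulA : associative bmul.
Proof.
by move=> x y z; rewrite -[x]brepK -[y]brepK -[z]brepK !bmul_of catA.
Qed.
Fact bmul1 : left_id bone bmul.
Proof. by move=> x; rewrite -[x]brepK bmul_of. Qed.
Fact bmulr1 : right_id bone bmul.
Proof. by move=> x; rewrite -[x]brepK bmul_of cats0. Qed.
Lemma winv_cong w : braid_cong (w ++ winv w) [::].
Proof.
elim: w => [|[i b] w IH]; first exact: bc_refl.
have -> : ((i, b) :: w) ++ winv ((i, b) :: w) =
    [:: (i, b)] ++ ((w ++ winv w) ++ [:: (i, ~~ b)]).
  by rewrite /winv /= rev_cons -cats1 !catA.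
apply: bc_trans (bc_cancel i b).
exact: bc_cat (bc_refl [:: (i, b)]) (bc_cat IH (bc_refl [:: (i, ~~ b)])).
Qed.
Lemma winvK w : winv (winv w) = w.
Proof.
rewrite /winv map_rev revK -map_comp -[RHS]map_id.
by apply: eq_map => -[i b] /=; rewrite negbK.
Qed.
Fact bmulV : right_inverse bone binv bmul.
Proof.
move=> x; rewrite -{1}[x]brepK bmul_of; exact/braid_ofP/winv_cong.
Qed.
Fact bmulVl : left_inverse bone binv bmul.
Proof.
move=> x; rewrite -{2}[x]brepK bmul_of; apply/braid_ofP.
by rewrite -{2}[brep x]winvK; exact: winv_cong.
Qed.
HB.instance Definition _ := isGroup.Build braid bmulA bmul1 bmulr1 bmulVl bmulV.

Definition sigma (i : 'I_n.-1) : braid := braid_of [:: (i, true)].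

(* The multiplicative map on the braid group with sigma_i |-> x i, where xV i is
   the inverse of x i. *)
Section Eval.
Variables (D : pzRingType) (x xV : 'I_n.-1 -> D).

Definition weval (w : seq letter) : D :=
  \prod_(l <- w) (if l.2 then x l.1 else xV l.1).
Definition beval (b : braid) : D := weval (brep b).

Hypotheses (xVr : forall i, x i * xV i = 1) (xVl : forall i, xV i * x i = 1).
Hypothesis x_far : forall i j, far i j -> x i * x j = x j * x i.
Hypothesis x_braid : forall i j, adjacent i j ->
  x i * x j * x i = x j * x i * x j.

Lemma weval_cong w w' : braid_cong w w' -> weval w = weval w'.
Proof.
rewrite /weval; elim=> {w w'} //.
- by move=> w w' w'' _ -> _ ->.
- by move=> w1 w1' w2 w2' _ e1 _ e2; rewrite !big_cat /= e1 e2.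
- by move=> i [] /=; rewrite !big_cons !big_nil /= mulr1.
- by move=> i j /x_far; rewrite !big_cons !big_nil /= !mulr1.
- by move=> i j /x_braid; rewrite !big_cons !big_nil /= !mulr1 !mulrA.
Qed.
Lemma beval_of w : beval (braid_of w) = weval w.
Proof. exact/weval_cong/brep_cong. Qed.
Lemma beval1 : beval 1%g = 1.
Proof. by rewrite [LHS]beval_of /weval big_nil. Qed.
Lemma bevalM : {morph beval : a b / (a * b)%g >-> a * b}.
Proof. by move=> a b; rewrite [LHS]beval_of /weval big_cat. Qed.
Lemma beval_sigma i : beval (sigma i) = x i.
Proof. by rewrite beval_of /weval big_seq1. Qed.
End Eval.
End Braid.

Section Ground.
Variable K : realType.

(* C is K[i] for a realType K.  base = C[u,u^-1][v,v^-1] and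
   extbase = base[gamma,gamma^-1]. *)
Definition base : comPzRingType := laurent (laurent K[i]).
Definition extbase : comPzRingType := laurent base.

Definition lconst (A : pzRingType) (a : A) : laurent A := lmono 0 a.
Definition cplx (c : K[i]) : base := lconst (lconst c).
(* u ^ k *)
Definition upow (k : int) : base := lconst (lmono k 1).
Definition vvar : base := lmono 1 1.
End Ground.


Section PresentedExtra.
Variables (A : comPzRingType) (I : Type) (rel : pterm A I -> pterm A I -> Prop).
Lemma pclsM x y : pcls rel (Mul x y) = pcls rel x * pcls rel y.
Proof. by rewrite [RHS]pcls_mul. Qed.
Lemma pclsD x y : pcls rel (Add x y) = pcls rel x + pcls rel y.
Proof. by rewrite [RHS]pcls_add. Qed.
Lemma pcls_const a : pcls rel (Const a) = a *: (1 : presented rel).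
Proof. by rewrite -[LHS](mulr1 (pconst rel a)). Qed.
End PresentedExtra.

Section LaurentExtra.
Variable A : pzRingType.
Lemma lmonoM k l (a b : A) : lmono k a * lmono l b = lmono (k + l) (a * b).
Proof.
apply: laurentP => i; rewrite lcoef_monoM !lcoef_mono.
by rewrite subr_eq addrC; case: eqP => //; rewrite mulr0.
Qed.
Lemma lmonoD k (a b : A) : lmono k (a + b) = lmono k a + lmono k b.
Proof.
apply: laurentP => i; rewrite lcoefD !lcoef_mono.
by case: eqP => //; rewrite addr0.
Qed.
Lemma lconstM (a b : A) : lconst (a * b) = lconst a * lconst b.
Proof. by rewrite /lconst lmonoM add0r. Qed.
Lemma lconstD (a b : A) : lconst (a + b) = lconst a + lconst b.
Proof. exact: lmonoD. Qed.
Lemma lconst1 : lconst (1 : A) = 1. Proof. by []. Qed.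
Lemma lmono1_comm k (f : laurent A) : lmono k 1 * f = f * lmono k 1.
Proof.
by apply: laurentP => i; rewrite lcoef_monoM lcoef_Mmono mul1r mulr1.
Qed.
End LaurentExtra.

Section Hecke.
Variables (K : realType) (n : nat).
Local Notation B := (base K).

Section Relations.
Local Open Scope pterm_scope.
Local Notation tm := (pterm B 'I_n.-1).
Local Notation T i := (Gen i : tm).
Inductive hecke_rel : tm -> tm -> Prop :=
  | hecke_far i j : far i j -> hecke_rel (T i * T j) (T j * T i)
  | hecke_braid i j : adjacent i j ->
      hecke_rel (T i * T j * T i) (T j * T i * T j)
  | hecke_quad i :
      hecke_rel (T i * T i) (Const (upow K 2) + Const (vvar K) * T i).
End Relations.

Definition hecke : Type := presented hecke_rel.
HB.instance Definition _ := GRing.PzRing.on hecke.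
HB.instance Definition _ := GRing.Lmodule.on hecke.

Definition hT (i : 'I_n.-1) : hecke := pgen hecke_rel i.
(* T_i^-1 = u^-2 (T_i - v) *)
Definition hTV (i : 'I_n.-1) : hecke := upow K (-2) *: (hT i - vvar K *: (1 : hecke)).
(* u^-r T_(i_1) ... T_(i_r) for w = s_(i_1) ... s_(i_r) reduced *)
Definition hTt (w : 'S_n) : hecke :=
  upow K (- (plength w)%:Z) *: \prod_(i <- redexpr w) hT i.

Definition delta_hecke (b : braid n) : hecke := beval hT hTV b.
End Hecke.

Section HeckeSanity.
Variables (K : realType) (n : nat).
Implicit Types i j : 'I_n.-1.
Lemma hT_far i j : far i j -> hT K i * hT K j = hT K j * hT K i.
Proof. by move=> h; have /cong_rel/pclsP := hecke_far K h; rewrite !pclsM. Qed.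
Lemma hT_braid i j : adjacent i j ->
  hT K i * hT K j * hT K i = hT K j * hT K i * hT K j.
Proof. by move=> h; have /cong_rel/pclsP := hecke_braid K h; rewrite !pclsM. Qed.
Lemma hT_quad i :
  hT K i * hT K i = upow K 2 *: (1 : hecke K n) + vvar K *: hT K i.
Proof.
have /cong_rel/pclsP := hecke_quad K i.
by rewrite pclsD !pclsM !pcls_const -pscaleAl mul1r.
Qed.
Lemma upowD k l : upow K (k + l) = upow K k * upow K l.
Proof. by rewrite /upow -lconstM lmonoM mulr1. Qed.
Lemma upow0 : upow K 0 = 1. Proof. by []. Qed.
Lemma hT_hTV i : hT K i * hTV K i = 1.
Proof.
rewrite /hTV -pscaleAr mulrBr hT_quad -pscaleAr mulr1 addrK scalerA -upowD.
by rewrite addNr upow0 scale1r.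
Qed.
Lemma hTV_hT i : hTV K i * hT K i = 1.
Proof.
rewrite /hTV -pscaleAl mulrBl hT_quad -pscaleAl mul1r addrK scalerA -upowD.
by rewrite addNr upow0 scale1r.
Qed.
Lemma delta_hecke1 : delta_hecke K (1%g : braid n) = 1.
Proof. exact: (beval1 hT_hTV hTV_hT hT_far hT_braid). Qed.
Lemma delta_heckeM :
  {morph @delta_hecke K n : a b / (a * b)%g >-> a * b}.
Proof. exact: (bevalM hT_hTV hTV_hT hT_far hT_braid). Qed.
Lemma delta_hecke_sigma i : delta_hecke K (sigma i) = hT K i.
Proof. exact: (beval_sigma hT_hTV hTV_hT hT_far hT_braid). Qed.
End HeckeSanity.


(* The algebra map T_i |-> T_(f i); it is only used for maps f that preserve
   the difference of indices. *)
Definition hecke_map (K : realType) (m n : nat) (f : 'I_m.-1 -> 'I_n.-1) :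
    hecke K m -> hecke K n :=
  @plift _ _ (@hecke_rel K m) _ (fun b => b *: (1 : hecke K n)) (fun i => hT K (f i)).

Section HeckeMapTheory.
Variables (K : realType) (m n : nat) (f : 'I_m.-1 -> 'I_n.-1).
Hypotheses (f_far : forall i j, far i j -> far (f i) (f j))
  (f_adj : forall i j, adjacent i j -> adjacent (f i) (f j)).
Local Notation c := (fun b : base K => b *: (1 : hecke K n)).
Let phi i := hT K (f i).

Fact hecke_map_subproof x y :
  @hecke_rel K m x y -> teval c phi x = teval c phi y.
Proof.
case=> [i j /f_far h|i j /f_adj h|i] /=; first exact: hT_far.
  exact: hT_braid.
by rewrite -pscaleAl mul1r; exact: hT_quad.
Qed.
Fact cst_D : {morph c : a b / a + b}.
Proof. by move=> a b; rewrite scalerDl. Qed.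
Fact cst_M : {morph c : a b / a * b}.
Proof. by move=> a b; rewrite -pscaleAl mul1r [RHS]scalerA. Qed.
Fact cst_1 : c 1 = 1. Proof. exact: scale1r. Qed.
Fact cst_C b y : c b * y = y * c b.
Proof. by rewrite -pscaleAl -pscaleAr mul1r mulr1. Qed.
Local Notation thm L := (L _ _ _ _ _ _ cst_D cst_M cst_1 cst_C hecke_map_subproof).
Lemma hecke_map_gen i : hecke_map f (hT K i) = hT K (f i).
Proof. exact: (thm plift_gen). Qed.
Lemma hecke_map_const b : hecke_map f (b *: (1 : hecke K m)) = b *: (1 : hecke K n).
Proof. by rewrite -pcls_const; exact: (thm plift_const). Qed.
Lemma hecke_mapD : {morph @hecke_map K m n f : x y / x + y}.
Proof. exact: (thm pliftD). Qed.
Lemma hecke_mapM : {morph @hecke_map K m n f : x y / x * y}.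
Proof. exact: (thm pliftM). Qed.
End HeckeMapTheory.

Definition hecke_incl (K : realType) (m : nat) : hecke K m.+1 -> hecke K m.+2 :=
  hecke_map (m := m.+1) (n := m.+2) (widen_ord (leqnSn m)).

(* The characterisation of the unique family (tau_n); ord_max is the index of
   the last generator T_(n+1) of H_(n+2). *)
Record markov_family (K : realType) (tau : forall n, hecke K n -> base K) :
    Prop := {
  mf_linear : forall n (b : base K) (x y : hecke K n),
    tau n (b *: x + y) = b * tau n x + tau n y;
  mf_zero : forall b : base K, tau 0%N (b *: (1 : hecke K 0)) = b;
  mf_one : tau 1%N 1 = 1;
  mf_trace : forall n (x y : hecke K n.+1), tau n.+1 (x * y) = tau n.+1 (y * x);
  mf_markov : forall n (x : hecke K n.+1),
    tau n.+2 (hecke_incl x * hT K (ord_max : 'I_n.+2.-1)) = tau n.+1 x;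
  mf_markovV : forall n (x : hecke K n.+1),
    tau n.+2 (hecke_incl x * hTV K (ord_max : 'I_n.+2.-1)) = tau n.+1 x
}.

Section Compositions.
Variables (d n : nat).

Definition composition : finType :=
  {mu : {ffun 'I_d -> 'I_n.+1} | (\sum_a mu a == n)%N}.
Definition part (mu : composition) (a : 'I_d) : nat := val mu a.

Lemma sum_part mu : (\sum_a part mu a = n)%N.
Proof. exact/eqP/(valP mu). Qed.

Definition blocks (mu : composition) : seq 'I_d :=
  flatten [seq nseq (part mu a) a | a <- enum 'I_d].
Fact size_blocks mu : size (blocks mu) == n.
Proof.
rewrite size_flatten /shape -map_comp sumnE big_map big_enum /=.
by under eq_bigr do rewrite size_nseq; rewrite sum_part.
Qed.
(* A character chi of (Z/dZ)^n is encoded by the function j |-> a with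
   chi(t_j) = xi_a, where xi enumerates the d-th roots of unity. *)
Definition chi1 (mu : composition) : {ffun 'I_n -> 'I_d} :=
  [ffun j => tnth (Tuple (size_blocks mu)) j].

(* chi1 mu j is also the index of the consecutive block that contains j. *)
Definition young (mu : composition) : {set 'S_n} :=
  [set w : 'S_n | [forall j, chi1 mu (w j) == chi1 mu j]].

Definition multinom (mu : composition) : nat :=
  (n`! %/ \prod_a (part mu a)`!)%N.

Definition minreps (mu : composition) : {set 'S_n} :=
  [set p : 'S_n | [forall h in young mu, plength p <= plength (pcomp p h)]%N].
(* pi_(1,mu) = 1, ..., pi_(m,mu), with the identity listed first. *)
Definition mrep (mu : composition) (k : 'I_(multinom mu)) : 'S_n :=
  nth 1%g (1%g :: enum (minreps mu :\ 1%g)) k.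

Definition char_act (w : 'S_n) (chi : {ffun 'I_n -> 'I_d}) :
    {ffun 'I_n -> 'I_d} := [ffun j => chi (w^-1%g j)].
Definition chik (mu : composition) (k : 'I_(multinom mu)) :
    {ffun 'I_n -> 'I_d} :=
  char_act (mrep k) (chi1 mu).

Definition has_comp (mu : composition) (chi : {ffun 'I_n -> 'I_d}) : bool :=
  [forall a, #|[set j | chi j == a]| == part mu a].

Definition composition0 : finType :=
  {m : {ffun 'I_d -> bool} | [exists a, m a]}.
Definition weight0 (m : composition0) : nat := (\sum_a val m a)%N.
(* [mu] = m *)
Definition comp_supp (mu : composition) (m : composition0) : bool :=
  [forall a, (1 <= part mu a)%N == val m a].

Definition offset (mu : composition) (a : 'I_d) : nat :=
  (\sum_(b < d | b < a) part mu b)%N.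
Fact offset_subproof mu a (i : 'I_(part mu a).-1) :
  (offset mu a + i < n.-1)%N.
Proof.
have le : (offset mu a + part mu a <= n)%N.
  rewrite -[leqRHS](sum_part mu) (bigID (fun b : 'I_d => (b < a)%N)) /= leq_add2l.
  by rewrite (bigD1 a) ?ltnn //= leq_addr.
have := ltn_ord i; rewrite !ltn_predRL => lt.
by rewrite -addnS; apply: leq_trans le; rewrite ltn_add2l.
Qed.
Definition block_gen mu a (i : 'I_(part mu a).-1) : 'I_n.-1 :=
  Ordinal (offset_subproof i).
End Compositions.

Section YoungHecke.
Variables (K : realType) (d n : nat) (mu : composition d n).

Inductive in_young_hecke : hecke K n -> Prop :=
  | iyh_gen i : sgen i \in young mu -> in_young_hecke (hT K i)
  | iyh_const b : in_young_hecke (b *: (1 : hecke K n))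
  | iyh_add x y : in_young_hecke x -> in_young_hecke y -> in_young_hecke (x + y)
  | iyh_mul x y : in_young_hecke x -> in_young_hecke y -> in_young_hecke (x * y).

(* The embedding of the a-th tensor factor under the identification of H^mu with
   H_(mu_1) (x) ... (x) H_(mu_d). *)
Definition block_emb (a : 'I_d) : hecke K (part mu a) -> hecke K n :=
  hecke_map (@block_gen d n mu a).

(* f is tau_(mu_1) (x) ... (x) tau_(mu_d) on H^mu; values of f outside H^mu are
   irrelevant. *)
Definition tensor_trace (tau : forall n, hecke K n -> base K)
    (f : hecke K n -> base K) : Prop :=
  (forall b x y, in_young_hecke x -> in_young_hecke y ->
     f (b *: x + y) = b * f x + f y) /\
  (forall x : forall a, hecke K (part mu a),
     f (\prod_a block_emb (x a)) = \prod_a tau (part mu a) (x a)).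
End YoungHecke.

Section Yokonuma.
Variables (K : realType) (d n : nat).
Local Notation B := (base K).

Inductive yh_gen : Type := yg of 'I_n.-1 | yt of 'I_n.

Section Relations.
Local Open Scope pterm_scope.
Local Notation tm := (pterm B yh_gen).
Local Notation g i := (Gen (yg i) : tm).
Local Notation t j := (Gen (yt j) : tm).
Definition tmpow (x : tm) (k : nat) : tm := iter k (Mul x) (Const 1%R).
Definition tmsum (s : seq tm) : tm := foldr Add (Const 0%R) s.
(* e_i, with t^-s written t^(d-s), as t^d = 1. *)
Definition tm_e (i : 'I_n.-1) : tm :=
  Const (cplx d%:R^-1) *
  tmsum [seq tmpow (t (slo i)) s * tmpow (t (shi i)) (d - s) | s <- iota 0 d].

Inductive yh_rel : tm -> tm -> Prop :=
  | yh_far i j : far i j -> yh_rel (g i * g j) (g j * g i)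
  | yh_braid i j : adjacent i j -> yh_rel (g i * g j * g i) (g j * g i * g j)
  | yh_tt i j : yh_rel (t i * t j) (t j * t i)
  | yh_gt i j : yh_rel (g i * t j) (t (sgen i j) * g i)
  | yh_td j : yh_rel (tmpow (t j) d) (Const 1%R)
  | yh_quad i :
      yh_rel (g i * g i) (Const (upow K 2) + Const (vvar K) * (tm_e i * g i)).
End Relations.

Definition yh : Type := presented yh_rel.
HB.instance Definition _ := GRing.PzRing.on yh.
HB.instance Definition _ := GRing.Lmodule.on yh.

Definition yG (i : 'I_n.-1) : yh := pgen yh_rel (yg i).
Definition yT (j : 'I_n) : yh := pgen yh_rel (yt j).
Definition ye (i : 'I_n.-1) : yh :=
  (cplx d%:R^-1 : B) *: \sum_(s < d) yT (slo i) ^+ s * yT (shi i) ^+ (d - s).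
(* g_i^-1 = u^-2 (g_i - v e_i) *)
Definition yGV (i : 'I_n.-1) : yh :=
  upow K (-2) *: (yG i - vvar K *: ye i).
Definition yGt (w : 'S_n) : yh :=
  upow K (- (plength w)%:Z) *: \prod_(i <- redexpr w) yG i.

(* R (x)_B Y is Y[gamma,gamma^-1], because R = B[gamma,gamma^-1]. *)
Definition gam (k : int) : laurent yh := lmono k 1.
Definition delta_gen (i : 'I_n.-1) : laurent yh :=
  (gam 1 + (1 - gam 1) * lconst (ye i)) * lconst (yG i).
(* The inverse of delta_gen i, see delta_gen_genV. *)
Definition delta_genV (i : 'I_n.-1) : laurent yh :=
  lconst (yGV i) * (gam (-1) + (1 - gam (-1)) * lconst (ye i)).
Definition delta_yh (b : braid n) : laurent yh := beval delta_gen delta_genV b.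

Variable xi : 'I_d -> K[i].

Definition roots_of_unity : Prop :=
  (forall a, xi a ^+ d = 1) /\ injective xi.

Definition yE (chi : {ffun 'I_n -> 'I_d}) : yh :=
  \prod_i ((cplx d%:R^-1 : B) *:
           \sum_(s < d) (cplx (xi (chi i) ^+ s) : B) *: yT i ^+ (d - s)).
Definition yEmu (mu : composition d n) : yh := \sum_(chi | has_comp mu chi) yE chi.

Section Psi.
Variable mu : composition d n.
Local Notation m := (multinom mu).

Definition elem_mx (k j : 'I_m) (h : hecke K n) : 'M[hecke K n]_m :=
  \matrix_(p, q) (if (p == k) && (q == j) then h else 0).

(* Psi represents an algebra isomorphism from E_mu Y, with unit E_mu, onto
   Mat_m(H^mu), inside Mat_m(H_n); only its values on E_mu Y matter. *)
Record is_Psi (Psi : yh -> 'M[hecke K n]_m) : Prop := {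
  psi_linear : forall (b : B) (x y : yh),
    Psi (yEmu mu * (b *: x + y)) =
    map_mx (fun h => b *: h) (Psi (yEmu mu * x)) + Psi (yEmu mu * y);
  psi_mul : forall x y : yh,
    Psi (yEmu mu * x * (yEmu mu * y)) = Psi (yEmu mu * x) *m Psi (yEmu mu * y);
  psi_one : Psi (yEmu mu) = 1%:M;
  psi_inj : forall x y : yh,
    Psi (yEmu mu * x) = Psi (yEmu mu * y) -> yEmu mu * x = yEmu mu * y;
  psi_range : forall M : 'M[hecke K n]_m,
    (forall p q, in_young_hecke mu (M p q)) <->
    (exists x : yh, M = Psi (yEmu mu * x));
  psi_basis : forall (k j : 'I_m) (w : 'S_n),
    char_act w (chik j) = chik k ->
    Psi (yE (chik k) * yGt w) =
    elem_mx k j (hTt K (pcomp (pcomp (mrep k)^-1%g w) (mrep j)))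
}.
End Psi.
End Yokonuma.

Section YHSanity.
Variables (K : realType) (d n : nat).
Hypothesis d_gt0 : (0 < d)%N.
Implicit Types (i j : 'I_n.-1) (p q : 'I_n).
Local Notation g := (@yG K d n).
Local Notation t := (@yT K d n).
Local Notation Y := (yh K d n).

Lemma yG_far i j : far i j -> g i * g j = g j * g i.
Proof. by move=> h; have /cong_rel/pclsP := yh_far K d h; rewrite !pclsM. Qed.
Lemma yG_braid i j : adjacent i j -> g i * g j * g i = g j * g i * g j.
Proof. by move=> h; have /cong_rel/pclsP := yh_braid K d h; rewrite !pclsM. Qed.
Lemma yT_comm p q : t p * t q = t q * t p.
Proof. by have /cong_rel/pclsP := yh_tt K d p q; rewrite !pclsM. Qed.
Lemma yG_T i p : g i * t p = t (sgen i p) * g i.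
Proof. by have /cong_rel/pclsP := yh_gt K d i p; rewrite !pclsM. Qed.
Lemma pcls_tmpow x k :
  pcls (@yh_rel K d n) (tmpow x k) = pcls (@yh_rel K d n) x ^+ k.
Proof.
elim: k => [|k IH]; first by rewrite /= pcls_const scale1r.
by rewrite [tmpow _ _]/= pclsM IH exprS.
Qed.
Lemma yT_d p : t p ^+ d = 1.
Proof.
have /cong_rel/pclsP := yh_td K d p.
by rewrite pcls_tmpow pcls_const scale1r.
Qed.
Lemma pcls_tm_e i : pcls (@yh_rel K d n) (tm_e K d i) = ye K d i.
Proof.
rewrite /tm_e pclsM pcls_const -pscaleAl mul1r; congr (_ *: _).
rewrite -(big_mkord xpredT (fun s => t (slo i) ^+ s * t (shi i) ^+ (d - s))).
rewrite /index_iota subn0; elim: (iota 0 d) => [|s r IH] /=.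
  by rewrite big_nil pcls_const scale0r.
by rewrite big_cons pclsD pclsM !pcls_tmpow IH.
Qed.
Lemma yG_quad i : g i * g i = upow K 2 *: (1 : Y) + vvar K *: (ye K d i * g i).
Proof.
have /cong_rel/pclsP := yh_quad K d i.
by rewrite pclsD 3!pclsM pcls_tm_e !pcls_const -!pscaleAl !mul1r.
Qed.

Definition yep p q : Y :=
  (cplx d%:R^-1 : base K) *: \sum_(s < d) t p ^+ s * t q ^+ (d - s).
Lemma yeE i : ye K d i = yep (slo i) (shi i). Proof. by []. Qed.

Lemma yG_Tx i p k : g i * t p ^+ k = t (sgen i p) ^+ k * g i.
Proof.
elim: k => [|k IH]; first by rewrite mulr1 mul1r.
by rewrite !exprS mulrA yG_T -mulrA IH mulrA.
Qed.
Lemma yG_ep i p q : g i * yep p q = yep (sgen i p) (sgen i q) * g i.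
Proof.
rewrite /yep -pscaleAr -pscaleAl mulr_sumr mulr_suml; congr (_ *: _).
by apply: eq_bigr => s _; rewrite mulrA yG_Tx -mulrA yG_Tx mulrA.
Qed.
Lemma yTX_comm p q k l : GRing.comm (t p ^+ k) (t q ^+ l).
Proof. exact/commrX/commr_sym/commrX/yT_comm. Qed.
Lemma sum_shift p q :
  \sum_(s < d) t p ^+ s * t q ^+ (d - s) =
  \sum_(s < d) t p ^+ s.+1 * t q ^+ (d - s.+1).
Proof.
case: d d_gt0 yT_d => // d' _ Hd.
rewrite big_ord_recl [RHS]big_ord_recr /= addrC subnn !expr0 subn0 !Hd.
by congr (_ + _).
Qed.
Lemma yepC p q : yep p q = yep q p.
Proof.
rewrite /yep sum_shift; congr (_ *: _).
rewrite (reindex_inj rev_ord_inj) /=; apply: eq_bigr => s _.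
have sd := ltn_ord s.
by rewrite subnSK // subKn ?(ltnW sd) // -[_ ^+ s * _]yTX_comm.
Qed.
Lemma yT_ep p q : t p * yep p q = t q * yep p q.
Proof.
rewrite /yep -!pscaleAr; congr (_ *: _).
rewrite {2}sum_shift !mulr_sumr; apply: eq_bigr => s _.
have sd := ltn_ord s.
rewrite [RHS]mulrA (commrX s.+1 (yT_comm q p)) -[RHS]mulrA -exprS subnSK //.
by rewrite mulrA -exprS.
Qed.
Lemma yepp p q : yep p q * yep p q = yep p q.
Proof.
have TX k : t p ^+ k * yep p q = t q ^+ k * yep p q.
  elim: k => [|k IH]; first by rewrite !expr0.
  rewrite exprS -mulrA IH mulrA (commrX k (yT_comm p q)) -mulrA yT_ep.
  by rewrite mulrA -exprSr.
rewrite {1}/yep -pscaleAl mulr_suml.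
rewrite (eq_bigr (fun=> yep p q)); last first.
  move=> s _; rewrite yTX_comm -mulrA TX mulrA -exprD subnK ?yT_d ?mul1r //.
  exact/ltnW/ltn_ord.
rewrite sumr_const card_ord -(scaler_nat d (yep p q : Y)).
rewrite [LHS](scalerA _ _ (yep p q : Y)).
have -> : (cplx (d%:R^-1 : K[i]) : base K) * d%:R = 1.
  have cst m : (m%:R : base K) = cplx (m%:R : K[i]).
    elim: m => [|m IH].
      by apply: laurentP => k; apply: laurentP => l; rewrite /cplx !lcoef_mono;
         do 2?[case: eqP => _]; rewrite ?lcoef0 // lcoef_mono if_same.
    by rewrite mulrSr IH mulrSr /cplx !lconstD.
  by rewrite cst /cplx -!lconstM mulVf ?pnatr_eq0 -?lt0n.
by rewrite scale1r.
Qed.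
Lemma yep_comm p q p' q' : GRing.comm (yep p q) (yep p' q').
Proof.
have h x : (forall r, GRing.comm x (t r)) -> GRing.comm x (yep p' q').
  move=> hx; rewrite /GRing.comm /yep -pscaleAl -pscaleAr; congr (_ *: _).
  by apply: commr_sum => s _; apply: commrM; apply: commrX.
apply: h => r; apply: commr_sym.
rewrite /GRing.comm /yep -pscaleAl -pscaleAr; congr (_ *: _).
by apply: commr_sum => s _; apply: commrM; apply: commrX; exact: yT_comm.
Qed.

Definition aa p q : laurent Y := gam K d n 1 + (1 - gam K d n 1) * lconst (yep p q).
Lemma delta_genE i : delta_gen K d i = aa (slo i) (shi i) * lconst (g i).
Proof. by []. Qed.

Lemma lconst_comm (x y : Y) :
  GRing.comm x y -> GRing.comm (lconst x) (lconst y).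
Proof. by move=> h; rewrite /GRing.comm -!lconstM h. Qed.
Lemma gam_comm k x : GRing.comm x (gam K d n k).
Proof. by rewrite /GRing.comm -lmono1_comm. Qed.
Lemma aaC p q : aa p q = aa q p. Proof. by rewrite /aa yepC. Qed.
Lemma comm_aa x p q : GRing.comm x (lconst (yep p q)) -> GRing.comm x (aa p q).
Proof.
move=> h; apply: commrD; first exact: gam_comm.
by apply: commrM h; apply: commrB; [exact: commr1 | exact: gam_comm].
Qed.
Lemma aa_comm p q p' q' : GRing.comm (aa p q) (aa p' q').
Proof.
apply/comm_aa/commr_sym/comm_aa/lconst_comm; exact: yep_comm.
Qed.
Lemma lg_aa i p q : lconst (g i) * aa p q = aa (sgen i p) (sgen i q) * lconst (g i).
Proof.
rewrite /aa mulrDr [RHS]mulrDl (gam_comm 1 (lconst (g i))); congr (_ + _).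
rewrite mulrA.
have -> : lconst (g i) * (1 - gam K d n 1) = (1 - gam K d n 1) * lconst (g i).
  by apply: commrB; [exact: commr1 | exact: gam_comm].
by rewrite -!mulrA -!lconstM yG_ep.
Qed.

Lemma sgen_lo i : sgen i (slo i) = shi i. Proof. exact: tpermL. Qed.
Lemma sgen_hi i : sgen i (shi i) = slo i. Proof. exact: tpermR. Qed.
Lemma sgen_out i p : p != slo i -> p != shi i -> sgen i p = p.
Proof. by move=> h1 h2; apply: tpermD; rewrite eq_sym. Qed.

Lemma delta_gen_far i j : far i j ->
  delta_gen K d i * delta_gen K d j = delta_gen K d j * delta_gen K d i.
Proof.
have H a b : far a b -> lconst (g a) * aa (slo b) (shi b) = aa (slo b) (shi b) * lconst (g a).
  move=> fab; rewrite lg_aa !sgen_out // -val_eqE /=; move: fab; rewrite /far; lia.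
move=> fij; rewrite !delta_genE.
have fji : far j i by rewrite /far orbC.
apply: commrM; apply: commr_sym; apply: commrM.
- exact: aa_comm.
- by apply: commr_sym; exact: H.
- exact: H.
- by apply: lconst_comm; exact: yG_far.
Qed.
Lemma delta_gen_braid i j : adjacent i j ->
  delta_gen K d i * delta_gen K d j * delta_gen K d i =
  delta_gen K d j * delta_gen K d i * delta_gen K d j.
Proof.
move=> ij; have e : slo j = shi i by apply: val_inj => /=; rewrite (eqP ij).
have n1 : sgen i (shi j) = shi j.
  by rewrite sgen_out // -val_eqE /=; move: ij; rewrite /adjacent; lia.
have n2 : sgen j (slo i) = slo i.
  by rewrite sgen_out // -val_eqE /=; move: ij; rewrite /adjacent; lia.
have X a b p q p' q' p'' q'' :
    aa p q * lconst (g a) * (aa p' q' * lconst (g b)) * (aa p'' q'' * lconst (g a)) =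
    aa p q * aa (sgen a p') (sgen a q')
      * aa (sgen a (sgen b p'')) (sgen a (sgen b q'')) * lconst (g a * g b * g a).
  have L c r s z : lconst (g c) * (aa r s * z) =
      aa (sgen c r) (sgen c s) * (lconst (g c) * z) by rewrite mulrA lg_aa mulrA.
  by rewrite !lconstM -!mulrA !L.
rewrite !delta_genE !X yG_braid //; congr (_ * _).
have E1 : sgen i (slo i) = slo j by rewrite e sgen_lo.
have E2 : sgen i (slo j) = slo i by rewrite e sgen_hi.
rewrite -!e !(n2, E1, E2, n1, sgen_lo, sgen_hi).
rewrite -mulrA [aa (slo i) (shi j) * _]aa_comm mulrA.
by rewrite [aa (slo i) (slo j) * _]aa_comm -mulrA [aa (slo i) (slo j) * _]aa_comm mulrA.
Qed.

Lemma ye_G i : ye K d i * g i = g i * ye K d i.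
Proof. by rewrite yG_ep sgen_lo sgen_hi yepC. Qed.
Lemma yG_GV i : g i * yGV K d i = 1.
Proof.
rewrite /yGV -pscaleAr mulrBr yG_quad -pscaleAr ye_G.
rewrite [X in _ *: X](addrK (vvar K *: (g i * ye K d i) : Y)).
by rewrite [LHS](scalerA _ _ (1 : Y)) -upowD addNr upow0 scale1r.
Qed.
Lemma yGV_G i : yGV K d i * g i = 1.
Proof.
rewrite /yGV -pscaleAl mulrBl yG_quad -[(vvar K *: ye K d i) * _]pscaleAl.
rewrite [X in _ *: X](addrK (vvar K *: (ye K d i * g i) : Y)).
by rewrite [LHS](scalerA _ _ (1 : Y)) -upowD addNr upow0 scale1r.
Qed.
Lemma gam_aaV k i : (gam K d n k + (1 - gam K d n k) * lconst (ye K d i)) *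
  (gam K d n (- k) + (1 - gam K d n (- k)) * lconst (ye K d i)) = 1.
Proof.
have ee : lconst (ye K d i) * lconst (ye K d i) = lconst (ye K d i).
  by rewrite -lconstM yeE yepp.
have cc : gam K d n k * gam K d n (- k) = 1 by rewrite lmonoM subrr mulr1.
have C := gam_comm (- k).
move: (gam K d n k) (gam K d n (- k)) (lconst (ye K d i)) ee cc C => c c' e ee cc C.
have E l : l + (1 - l) * e = l * (1 - e) + e.
  by rewrite mulrBl mul1r mulrBr mulr1 addrCA addrC addrAC.
have fe : (1 - e) * e = 0 by rewrite mulrBl mul1r ee subrr.
have ef : e * (1 - e) = 0 by rewrite mulrBr mulr1 ee subrr.
have ff : (1 - e) * (1 - e) = 1 - e by rewrite [LHS]mulrBr mulr1 fe subr0.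
have H1 : c * (1 - e) * (c' * (1 - e)) = 1 - e.
  by rewrite -mulrA [(1 - e) * (_ * _)]mulrA C -mulrA ff mulrA cc mul1r.
have H2 : c * (1 - e) * e = 0 by rewrite -mulrA fe mulr0.
have H3 : e * (c' * (1 - e)) = 0 by rewrite mulrA C -mulrA ef mulr0.
by rewrite !E [LHS]mulrDl [X in X + _ = _]mulrDr [X in _ + X = _]mulrDr H1 H2 H3 ee addr0 add0r subrK.
Qed.
Lemma delta_gen_genV i : delta_gen K d i * delta_genV K d i = 1.
Proof.
rewrite /delta_genV /delta_gen -mulrA [lconst (yG _ _ _) * _]mulrA -lconstM.
by rewrite yG_GV mul1r gam_aaV.
Qed.
Lemma delta_genV_gen i : delta_genV K d i * delta_gen K d i = 1.
Proof.
rewrite /delta_genV /delta_gen -mulrA [X in _ * X]mulrA.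
by rewrite -{2}[1]opprK gam_aaV mul1r -lconstM yGV_G.
Qed.

Lemma delta_yh1 : delta_yh K d (1%g : braid n) = 1.
Proof. exact: (beval1 delta_gen_genV delta_genV_gen delta_gen_far delta_gen_braid). Qed.
Lemma delta_yhM : {morph @delta_yh K d n : a b / (a * b)%g >-> a * b}.
Proof. exact: (bevalM delta_gen_genV delta_genV_gen delta_gen_far delta_gen_braid). Qed.
Lemma delta_yh_sigma i : delta_yh K d (sigma i) = delta_gen K d i.
Proof. exact: (beval_sigma delta_gen_genV delta_genV_gen delta_gen_far delta_gen_braid). Qed.
End YHSanity.

(* The coefficientwise extension of f, i.e. its R-linear extension when f is
   B-linear. *)
Definition lmap (A A' : pzRingType) (f : A -> A') (p : laurent A) : laurent A' :=
  [fsfun k in lsupp p => f (lcoef p k)].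

Section Invariants.
Variables (K : realType) (d : nat) (xi : 'I_d -> K[i]).

Variable tauT : forall n, composition d n -> hecke K n -> base K.
Variable Psi : forall n (mu : composition d n),
  yh K d n -> 'M[hecke K n]_(multinom mu).

Definition rho (m : composition0 d) (n : nat) (x : yh K d n) : base K :=
  \sum_(mu : composition d n | comp_supp mu m)
     tauT mu (\tr (Psi mu (yEmu xi mu * x))).
Definition Gamma_yh (m : composition0 d) (n : nat) (b : braid n) : extbase K :=
  lmap (@rho m n) (delta_yh K d b).
End Invariants.

Definition Gamma_hecke (K : realType) (tau : forall n, hecke K n -> base K)
    (n : nat) (b : braid n) : base K := tau n (delta_hecke K b).

Section Links.
Variable K : realType.
Local Notation R3 := 'rV[K]_3.
Local Open Scope classical_set_scope.

(* Oriented links in R^3, each component being parametrised by a 1-periodic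
   curve.  Tameness is not a field: a link isotopic to a closed braid is tame. *)
Record link : Type := Link {
  lk_comp : finType;
  lk_curve : lk_comp -> K -> R3;
  lk_cont : forall c, continuous (lk_curve c);
  lk_periodic : forall c s, lk_curve c (s + 1) = lk_curve c s;
  lk_inj : forall c c' s t, lk_curve c s = lk_curve c' t ->
    c = c' /\ exists k : int, s = t + k%:~R
}.

Definition is_knot (L : link) : Prop := #|lk_comp L| = 1%N.

(* An ambient isotopy H carries each component of f onto a component of g, the
   parametrisations differing by an orientation preserving homeomorphism phi of
   the circle. *)
Definition isotopic (I J : finType) (f : I -> K -> R3) (g : J -> K -> R3) :
    Prop :=
  exists H : K -> R3 -> R3,
    [/\ {within [set p : K * R3 | 0 <= p.1 <= 1],
          continuous (fun p : K * R3 => H p.1 p.2)},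
        forall s, 0 <= s <= 1 -> exists G : R3 -> R3,
          [/\ continuous (H s), continuous G, cancel (H s) G & cancel G (H s)],
        forall x, H 0 x = x &
        exists (c : I -> J) (phi : I -> K -> K),
          [/\ bijective c,
              forall i, continuous (phi i) /\ {homo phi i : s t / s < t},
              forall i s, phi i (s + 1) = phi i s + 1 &
              forall i s, H 1 (f i s) = g (c i) (phi i s)]].

Section Closure.
Variables (n : nat) (w : seq (letter n)).

(* The closed braid turns once around the z-axis, in size w + 1 equal sectors:
   sector k carries the crossing of the k-th letter, and the last one is
   trivial.  The strand at position q has radius q + 1 outside crossings.  At a
   crossing (i, b) the strand moving outwards passes above (b = true, a
   positive crossing) or below (b = false) the one moving inwards. *)
Definition position (k : nat) (p : 'I_n) : 'I_n :=
  foldl (fun q l => sgen l.1 q) p (take k w).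

Definition bperm : 'S_n := (\prod_(l <- w) sgen l.1)%g.

Definition cylindrical (r theta z : K) : R3 :=
  \row_(i < 3) nth 0 [:: r * cos theta; r * sin theta; z] i.

(* The strand starting at position p, for 0 <= x < 1. *)
Definition strand (p : 'I_n) (x : K) : R3 :=
  let y := x * (size w).+1%:R in
  let k := `|Num.floor y|%N in
  let q := position k p in
  let f := y - k%:R in
  let bump b := (if b then sin (pi * f) else - sin (pi * f)) in
  let rz := match ohead (drop k w) with
            | Some (i, b) =>
              if q == slo i then (f, bump b)
              else if q == shi i then (- f, bump (~~ b))
              else (0, 0)
            | None => (0, 0)
            end in
  cylindrical (q.+1%:R + rz.1) (2 * pi * x) rz.2.

(* The components of the closure are the cycles of bperm, each represented by
   its least element; a cycle of length l winds l times around the axis. *)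
Definition closure_comp : finType :=
  {p : 'I_n | [forall q in porbit bperm p, (p <= q)%N]}.

Definition closure_curve (c : closure_comp) (s : K) : R3 :=
  let l := #|porbit bperm (val c)| in
  let y := s * l%:R in
  let m := Num.floor y in
  strand ((bperm ^+ `|(m %% l)%Z|)%g (val c)) (y - m%:~R).
End Closure.

Definition closure_of (n : nat) (b : braid n) (L : link) : Prop :=
  exists w : seq (letter n),
    braid_of w = b /\ isotopic (@closure_curve n w) (@lk_curve L).
End Links.

(* Main.v *)
Require Import Defs.
From mathcomp Require Import all_boot all_order all_algebra all_fingroup.
From mathcomp Require Import all_classical all_reals all_analysis.
From mathcomp Require Import complex zify.
Import GRing.Theory Num.Theory.
Local Open Scope ring_scope.

Set Implicit Arguments.
Unset Strict Implicit.
Unset Printing Implicit Defensive.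

(* If the closure of beta is a knot, the permutation of beta is a single cycle.
   The image of beta in the Yokonuma--Hecke algebra moves t_p past itself as
   this permutation does, so a diagonal block E_chi x E_chi, on which t_p acts
   by chi(t_p) on both sides, vanishes unless chi is constant along the cycle.
   Only the compositions (0, .., n, .., 0) contribute, which forces
   |mu0| = 1.  For constant chi one has e_i E_chi = E_chi, so gamma disappears
   from the image of sigma_i, and Psi sends E_chi g_i to T_i. *)

(** * Coefficients of Laurent polynomials *)

Lemma lconst_inj (A : pzRingType) : injective (@lconst A).
Proof.
by move=> a b /(congr1 (fun f => lcoef f 0)); rewrite !lcoef_mono eqxx.
Qed.

(** Off the support [lmap] returns 0 without applying [f]; the condition [f 0 = 0] makes the two
    agree. *)
Lemma lcoef_lmap (A A' : pzRingType) (f : A -> A') (p : laurent A) k :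
  f 0 = 0 -> lcoef (lmap f p) k = f (lcoef p k).
Proof.
move=> f0; rewrite {1}/lcoef finmap.fsfunE; case: ifPn => // kp.
by rewrite lcoef_out.
Qed.

(** An isotopy matches components bijectively, so the closed braid has one component too. This is
    where topology enters the proof. *)
Lemma closure_of_knot (K : realType) (L : link K) n (b : braid n) :
  is_knot L -> closure_of b L ->
  exists2 w, braid_of w = b & #|closure_comp w| = 1%N.
Proof.
move=> L1 [w [wb [H [_ _ _ [c [phi [c_bij _ _ _]]]]]]].
by exists w; rewrite // (bij_eq_card c_bij).
Qed.

(** * Braid words whose permutation is a single cycle *)

Section SingleCycle.
Variables (n : nat) (w : seq (letter n)).
Hypothesis w1 : #|closure_comp w| = 1%N.

(** An invariant function takes at [p] the value it takes at the least element of the cycle of [p].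
    These least elements are the components of the closure, so there is only one of them. *)
Lemma closure_comp1_const (T : Type) (f : 'I_n -> T) :
  (forall p, f (bperm w p) = f p) -> forall p q, f p = f q.
Proof.
move=> fw; have fX i p : f ((bperm w ^+ i)%g p) = f p.
  by elim: i p => [|i IH] p; rewrite ?perm1 // expgSr permM fw IH.
have rep p : exists c : closure_comp w, f p = f (val c).
  pose m := [arg min_(q < p | q \in porbit (bperm w) p) (q : nat)].
  have [mp minm] : m \in porbit (bperm w) p /\
      forall q, q \in porbit (bperm w) p -> (m <= q)%N.
    by rewrite /m; case: arg_minnP; rewrite ?porbit_id.
  have cm : [forall q in porbit (bperm w) m, (m <= q)%N].
    apply/'forall_implyP => q qm; apply: minm.
    by move: mp qm; rewrite -!eq_porbit_mem => /eqP ->.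
  exists (exist _ m cm); case/porbitP: mp => i /= ->.
  by rewrite fX.
move=> p q; have [c ->] := rep p; have [c' ->] := rep q.
have /card_le1_eqP e : (#|closure_comp w| <= 1)%N by rewrite w1.
by rewrite (e c c').
Qed.

(** Excludes the empty braid, for which the composition (0, .., n, .., 0) would have empty
    support. *)
Lemma closure_comp1_gt0 : (0 < n)%N.
Proof.
have /card_gt0P[c _] : (0 < #|closure_comp w|)%N by rewrite w1.
exact: leq_ltn_trans (leq0n _) (ltn_ord (val c)).
Qed.
End SingleCycle.

(** * Characters with a given composition *)

Section Compositions.
Variables d n : nat.
Implicit Types (mu : composition d n) (a b : 'I_d).

Lemma count_blocks mu a : count_mem a (blocks mu) = part mu a.
Proof.
rewrite /blocks count_flatten -map_comp sumnE big_map big_enum /=.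
rewrite (bigD1 a) //= count_nseq /= eqxx mul1n big1 ?addn0 // => b ba.
by rewrite count_nseq /= (negPf ba).
Qed.

Lemma card_chi1 mu a : #|[set j | chi1 mu j == a]| = part mu a.
Proof.
rewrite -count_blocks; have -> : blocks mu = [seq chi1 mu j | j <- enum 'I_n].
  under eq_map do rewrite ffunE.
  exact/esym/(map_tnth_enum (Tuple (size_blocks mu))).
rewrite count_map -sum1_count big_enum_cond /= -sum1_card.
by apply: eq_bigl => j; rewrite inE.
Qed.

(** The permutation [mrep k] carries the level sets of [chi1 mu] bijectively onto those of
    [chik k]. *)
Lemma has_comp_chik mu (k : 'I_(multinom mu)) : has_comp mu (chik k).
Proof.
apply/forallP => a; rewrite -card_chi1; apply/eqP.
rewrite -(card_imset _ (@perm_inj _ (mrep k)^-1%g)); congr #|pred_of_set _|.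
apply/setP => j; apply/imsetP/idP => [[i h ->] | ].
  by move: h; rewrite !inE !ffunE.
move=> h; exists (mrep k j); rewrite ?permK //; move: h.
by rewrite !inE !ffunE permK.
Qed.

Lemma chi1_onto mu a : (0 < part mu a)%N -> exists j, chi1 mu j = a.
Proof. by rewrite -card_chi1 => /card_gt0P[j]; rewrite inE => /eqP; exists j. Qed.

Lemma has_comp_part mu chi j : has_comp mu chi -> (0 < part mu (chi j))%N.
Proof.
by move=> /forallP/(_ (chi j))/eqP <-; apply/card_gt0P; exists j; rewrite inE.
Qed.
End Compositions.

(** The cyclic shift of a sum over Z/dZ, which turns multiplication by t_j into a change of
    index. *)
Lemma sum_ord_shift (V : zmodType) (G : nat -> V) d :
  G 0%N = G d -> \sum_(s < d) G s = \sum_(s < d) G s.+1.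
Proof.
move=> G0d; apply: (addIr (G d)).
by rewrite -(big_ord_recr d (fun s => G s)) big_ord_recl G0d addrC.
Qed.

(** * Complex scalars inside the ground ring *)

Section Cplx.
Variable K : realType.
Implicit Types a b : K[i].

Lemma cplx1 : cplx 1 = 1 :> base K. Proof. by []. Qed.
Lemma cplxM a b : cplx (a * b) = cplx a * cplx b :> base K.
Proof. by rewrite /cplx !lconstM. Qed.
Lemma cplxD a b : cplx (a + b) = cplx a + cplx b :> base K.
Proof. by rewrite /cplx !lconstD. Qed.
Lemma cplx_nat m : cplx (m%:R : K[i]) = m%:R.
Proof.
elim: m => [|m IH]; last by rewrite !mulrSr cplxD IH.
by apply: (addIr (cplx 0 : base K)); rewrite -cplxD !add0r.
Qed.

(** The ground ring is not a field, but a difference of distinct complex numbers is invertible in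
    it. Hence a vector with two distinct complex eigenvalues vanishes. *)
Lemma cplx_scaler_inj (V : lmodType (base K)) a b (y : V) :
  a != b -> cplx a *: y = cplx b *: y -> y = 0.
Proof.
move=> ab e; rewrite -[y]scale1r -cplx1 -(@mulVf _ (a - b)) ?subr_eq0 //.
rewrite cplxM -scalerA.
have -> : cplx (a - b) *: y = 0.
  apply: (addIr (cplx b *: y)).
  by rewrite -scalerDl -cplxD subrK add0r.
by rewrite scaler0.
Qed.
End Cplx.

(** * Character idempotents and the image of a braid *)

Section CharacterIdempotents.
Variables (K : realType) (d n : nat) (xi : 'I_d -> K[i]).
Hypotheses (d_gt0 : (0 < d)%N) (xi_root : roots_of_unity xi).
Local Notation Y := (yh K d n).
Local Notation t := (@yT K d n).
Local Notation g := (@yG K d n).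
Implicit Types (i : 'I_n.-1) (j p q : 'I_n) (a : 'I_d) (y : Y).
Implicit Types chi : {ffun 'I_n -> 'I_d}.

Lemma yscaleA (b c : base K) y : b *: (c *: y) = (b * c) *: y.
Proof. exact: scalerA. Qed.

(** One factor of [yE]: the projection onto the eigenspace of [t j] for the eigenvalue [xi a]. *)
Definition yTE j a : Y := (cplx d%:R^-1 : base K) *:
  \sum_(s < d) (cplx (xi a ^+ s) : base K) *: t j ^+ (d - s).

(** Multiplying by [t j] shifts the index of the sum by one, as multiplying by [xi a] does; the end
    terms agree because both d-th powers are 1. *)
Lemma yT_yTE j a : t j * yTE j a = (cplx (xi a) : base K) *: yTE j a.
Proof.
rewrite /yTE -pscaleAr [RHS]yscaleA mulrC -[RHS]yscaleA; congr (_ *: _).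
rewrite mulr_sumr scaler_sumr.
pose G s : Y := (cplx (xi a ^+ s) : base K) *: t j ^+ (d - s).+1.
rewrite (eq_bigr (fun s : 'I_d => G s)); last first.
  by move=> s _; rewrite -pscaleAr -exprS.
rewrite (sum_ord_shift (G := G)); last first.
  by rewrite /G subn0 subnn expr0 xi_root.1 exprSr yT_d // mul1r expr1.
by apply: eq_bigr => s _; rewrite /G subnSK // yscaleA -cplxM exprS.
Qed.

(** Every term equals [y] since [xi a ^+ d = 1]. This is how averages over Z/dZ are seen to fix
    eigenvectors. *)
Lemma sum_cplx_root a y :
  (cplx d%:R^-1 : base K) *: \sum_(s < d)
    (cplx (xi a ^+ s) : base K) *: ((cplx (xi a ^+ (d - s)) : base K) *: y) = y.
Proof.
rewrite (eq_bigr (fun=> y)); last first.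
  move=> s _; rewrite yscaleA -cplxM -exprD subnKC ?xi_root.1 ?cplx1 ?scale1r //.
  exact/ltnW/ltn_ord.
rewrite sumr_const card_ord -(scaler_nat d (y : Y)) [LHS]yscaleA.
rewrite -cplx_nat -cplxM mulVf ?scale1r //.
by rewrite pnatr_eq0 -lt0n.
Qed.

Lemma yTX_eigenl j a y k : t j * y = (cplx (xi a) : base K) *: y ->
  t j ^+ k * y = (cplx (xi a ^+ k) : base K) *: y.
Proof.
move=> e; elim: k => [|k IH]; first by rewrite !expr0 mul1r cplx1 scale1r.
by rewrite !exprS -mulrA IH -pscaleAr e [LHS]yscaleA -cplxM mulrC.
Qed.
Lemma yTX_eigenr j a y k : y * t j = (cplx (xi a) : base K) *: y ->
  y * t j ^+ k = (cplx (xi a ^+ k) : base K) *: y.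
Proof.
move=> e; elim: k => [|k IH]; first by rewrite !expr0 mulr1 cplx1 scale1r.
by rewrite !exprSr mulrA IH -pscaleAl e [LHS]yscaleA -cplxM.
Qed.

Lemma yTE_eigenl j a y : t j * y = (cplx (xi a) : base K) *: y -> yTE j a * y = y.
Proof.
move=> e; rewrite /yTE -pscaleAl mulr_suml -[RHS](sum_cplx_root a).
by congr (_ *: _); apply: eq_bigr => s _; rewrite -pscaleAl (yTX_eigenl _ e).
Qed.
Lemma yTE_eigenr j a y : y * t j = (cplx (xi a) : base K) *: y -> y * yTE j a = y.
Proof.
move=> e; rewrite /yTE -pscaleAr mulr_sumr -[RHS](sum_cplx_root a).
by congr (_ *: _); apply: eq_bigr => s _; rewrite -pscaleAr (yTX_eigenr _ e).
Qed.

Lemma yT_yTE_comm p j a : GRing.comm (t p) (yTE j a).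
Proof.
rewrite /GRing.comm /yTE -pscaleAr -pscaleAl; congr (_ *: _).
apply: commr_sum => s _; rewrite /GRing.comm -pscaleAr -pscaleAl; congr (_ *: _).
exact/commrX/yT_comm.
Qed.

Lemma yT_yE j chi : t j * yE xi chi = (cplx (xi (chi j)) : base K) *: yE xi chi.
Proof.
rewrite /yE; move: (mem_index_enum j); elim: (index_enum _) => // i r IH.
rewrite inE !big_cons mulrA; have [<- _|ne /IH e] := eqVneq j i.
  by rewrite yT_yTE -pscaleAl.
by rewrite yT_yTE_comm -mulrA e -pscaleAr.
Qed.
Lemma yE_yT j chi : yE xi chi * t j = (cplx (xi (chi j)) : base K) *: yE xi chi.
Proof.
rewrite -yT_yE; apply/esym/commr_prod => i _; exact: yT_yTE_comm.
Qed.

Lemma yE_eigenl chi y :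
  (forall j, t j * y = (cplx (xi (chi j)) : base K) *: y) -> yE xi chi * y = y.
Proof.
move=> e; rewrite /yE; elim/big_rec: _ => [|j z _ IH]; first exact: mul1r.
by rewrite -mulrA IH; apply: yTE_eigenl.
Qed.
Lemma yE_eigenr chi y :
  (forall j, y * t j = (cplx (xi (chi j)) : base K) *: y) -> y * yE xi chi = y.
Proof.
move=> e; rewrite /yE; elim/big_rec: _ => [|j z _ IH]; first exact: mulr1.
by rewrite mulrA (yTE_eigenr (e j)).
Qed.

Lemma yE_idem chi : yE xi chi * yE xi chi = yE xi chi.
Proof. by apply: yE_eigenl => j; exact: yT_yE. Qed.

(** A [t j] on which the characters differ, placed between the two idempotents, acts by one scalar
    to the left and by another to the right. *)
Lemma yE_orth chi chi' : chi != chi' -> yE xi chi * yE xi chi' = 0.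
Proof.
move=> ne; have [j nej] : exists j, chi j != chi' j.
  by apply/existsP; rewrite -negb_forall; apply: contra ne => /eqfunP/ffunP ->.
apply: (@cplx_scaler_inj _ _ (xi (chi j)) (xi (chi' j))).
  by apply: contra nej => /eqP/xi_root.2 ->.
by rewrite pscaleAl -yE_yT -mulrA yT_yE pscaleAr.
Qed.

Lemma yEmu_yE (mu : composition d n) chi :
  has_comp mu chi -> yEmu xi mu * yE xi chi = yE xi chi.
Proof.
move=> muchi; rewrite /yEmu mulr_suml (bigD1 chi) //= yE_idem big1 ?addr0 //.
by move=> chi' /andP[_]; exact: yE_orth.
Qed.
Lemma yE_yEmu (mu : composition d n) chi :
  has_comp mu chi -> yE xi chi * yEmu xi mu = yE xi chi.
Proof.
move=> muchi; rewrite /yEmu mulr_sumr (bigD1 chi) //= yE_idem big1 ?addr0 //.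
by move=> chi' /andP[_ ne]; apply: yE_orth; rewrite eq_sym.
Qed.

Lemma sgenK i : involutive (sgen i).
Proof. exact: tpermK. Qed.

(** The factor in gamma and e_i commutes with every t_p, so the indices are permuted by g_i
    alone. *)
Lemma delta_gen_yT i p :
  lconst (t p) * delta_gen K d i = delta_gen K d i * lconst (t (sgen i p)).
Proof.
rewrite delta_genE -mulrA -lconstM yG_T sgenK lconstM !mulrA; congr (_ * _).
apply/comm_aa/lconst_comm; rewrite /GRing.comm /yep -pscaleAl -pscaleAr.
by congr (_ *: _); apply: commr_sum => s _; apply: commrM; apply/commrX/yT_comm.
Qed.

(** Obtained by multiplying the relation for [delta_gen] by the inverse on both sides. *)
Lemma delta_genV_yT i p :
  lconst (t p) * delta_genV K d i = delta_genV K d i * lconst (t (sgen i p)).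
Proof.
rewrite -[LHS]mul1r -(delta_genV_gen K d_gt0 i) mulrA -[_ * _ * lconst _]mulrA.
rewrite -{1}[p](sgenK i) -delta_gen_yT -mulrA -[_ * _ * delta_genV _ _ _]mulrA.
by rewrite delta_gen_genV // mulr1.
Qed.

(** Moving from left to right, [t p] meets the first letter first; the product in [bperm] also
    applies the first letter first. *)
Lemma delta_yh_yT (w : seq (letter n)) p :
  let W := weval (@delta_gen K d n) (@delta_genV K d n) w in
  lconst (t p) * W = W * lconst (t (bperm w p)).
Proof.
rewrite /weval /bperm /=; elim: w p => [|[i b] w IH] p.
  by rewrite !big_nil perm1 mulr1 mul1r.
rewrite !big_cons permM /= mulrA.
have -> : lconst (t p) * (if b then delta_gen K d i else delta_genV K d i) =
    (if b then delta_gen K d i else delta_genV K d i) * lconst (t (sgen i p)).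
  by case: b; [exact: delta_gen_yT | exact: delta_genV_yT].
by rewrite -[LHS]mulrA IH mulrA.
Qed.

(** Write E for the idempotent and x for the coefficient. Then E t_p x E = E x t_q E with q =
    [bperm w p], and the two sides are E x E times distinct roots of unity. *)
Lemma yE_delta_yh_yE (w : seq (letter n)) chi p k : chi (bperm w p) != chi p ->
  yE xi chi * lcoef (weval (@delta_gen K d n) (@delta_genV K d n) w) k
    * yE xi chi = 0.
Proof.
move=> ne; set x := lcoef _ _.
have tx : t p * x = x * t (bperm w p).
  have := congr1 (fun f => lcoef f k) (delta_yh_yT w p).
  by rewrite /= lcoef_monoM lcoef_Mmono subr0.
apply: (@cplx_scaler_inj _ _ (xi (chi (bperm w p))) (xi (chi p))).
  by apply: contra ne => /eqP/xi_root.2 ->.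
by rewrite pscaleAr -yT_yE mulrA -[_ * x * t _]mulrA -tx mulrA yE_yT -!pscaleAl.
Qed.

Section Constant.
Variable a : 'I_d.
Let chi : {ffun 'I_n -> 'I_d} := [ffun=> a].
Local Notation E := (yE xi chi).

(** Since g_i only permutes the t_j, on which a constant character takes one value, both products
    are eigenvectors on both sides and equal E g_i E. *)
Lemma yE_const_yG i : E * g i = g i * E.
Proof.
transitivity (E * g i * E).
  by apply/esym/yE_eigenr => j; rewrite -mulrA yG_T mulrA yE_yT !ffunE -pscaleAl.
rewrite -mulrA; apply: yE_eigenl => j.
by rewrite mulrA -{1}[j](sgenK i) -yG_T -mulrA yT_yE !ffunE -pscaleAr.
Qed.

(** Both t's in e_i act on [E] by [xi a], so each term of the average acts by [xi a ^+ d = 1]. *)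
Lemma ye_yE_const i : ye K d i * E = E.
Proof.
rewrite /ye -pscaleAl mulr_suml -[RHS](sum_cplx_root a); congr (_ *: _).
apply: eq_bigr => s _; rewrite -mulrA.
rewrite (@yTX_eigenl (shi i) a) ?yT_yE ?ffunE // -pscaleAr.
by rewrite (@yTX_eigenl (slo i) a) ?yT_yE ?ffunE // [LHS]yscaleA mulrC -[LHS]yscaleA.
Qed.
Lemma yE_const_ye i : E * ye K d i = E.
Proof.
rewrite /ye -pscaleAr mulr_sumr -[RHS](sum_cplx_root a); congr (_ *: _).
apply: eq_bigr => s _; rewrite mulrA.
rewrite (@yTX_eigenr (slo i) a) ?yE_yT ?ffunE // -pscaleAl.
by rewrite (@yTX_eigenr (shi i) a) ?yE_yT ?ffunE.
Qed.

Lemma yE_const_yGV i : E * yGV K d i = yGV K d i * E.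
Proof.
rewrite /yGV -pscaleAl -pscaleAr mulrBl mulrBr yE_const_yG -pscaleAl -pscaleAr.
by rewrite ye_yE_const yE_const_ye.
Qed.

(** Once e_i acts as 1, the factor becomes gamma^k + (1 - gamma^k) = 1. The cases k = 1 and k = -1
    serve for a generator and its inverse. *)
Lemma lconst_yE_aa k i :
  lconst E * (gam K d n k + (1 - gam K d n k) * lconst (ye K d i)) = lconst E.
Proof.
have C : GRing.comm (lconst E) (1 - gam K d n k).
  by apply: commrB; [exact: commr1 | exact: gam_comm].
by rewrite mulrDr mulrA C -mulrA -lconstM yE_const_ye gam_comm -mulrDl subrKC mul1r.
Qed.

(** [E] removes gamma from the first letter, commutes past what remains of it, and does the same to
    the next letter. *)
Lemma yE_const_delta_yh (w : seq (letter n)) :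
  lconst E * weval (@delta_gen K d n) (@delta_genV K d n) w =
  lconst (E * weval g (@yGV K d n) w).
Proof.
rewrite /weval lconstM; elim: w => [|[i b] w IH]; first by rewrite !big_nil.
rewrite !big_cons lconstM !mulrA /=.
have -> : lconst E * (if b then delta_gen K d i else delta_genV K d i) =
    lconst E * lconst (if b then g i else yGV K d i).
  case: b; first by rewrite /delta_gen mulrA lconst_yE_aa.
  rewrite /delta_genV mulrA -lconstM yE_const_yGV lconstM -mulrA.
  by rewrite lconst_yE_aa.
have C : GRing.comm (lconst E) (lconst (if b then g i else yGV K d i)).
  by apply: lconst_comm; case: b; [exact: yE_const_yG | exact: yE_const_yGV].
by rewrite C -mulrA IH mulrA.
Qed.
End Constant.
End CharacterIdempotents.

(** * Reduced expressions of the identity and of simple transpositions *)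

Section SimpleTranspositions.
Variable n : nat.
Implicit Types i j : 'I_n.-1.

(** The word [r] shows that some word has product [w], hence one of least length exists and [xget]
    does not fall back on its default. *)
Lemma redexprP (w : 'S_n) r : sword r = w ->
  sword (redexpr w) = w /\ (size (redexpr w) <= size r)%N.
Proof.
move=> rw; have [] : [set r | sword r = w /\ reduced r]%classic (redexpr w).
  apply: xgetPex; pose P k := `[< exists2 r', sword r' = w & size r' = k >].
  have exP : exists k, P k by exists (size r); apply/asboolP; exists r.
  case: (ex_minnP exP) => k /asboolP[r' r'w <-] kmin.
  exists r'; split=> // s sr'; apply: kmin; apply/asboolP; exists s => //.
  by rewrite sr'.
by move=> e red; split=> //; apply: red; rewrite e.
Qed.

Lemma redexpr1 : redexpr (1%g : 'S_n) = [::].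
Proof.
by apply/eqP; rewrite -size_eq0 -leqn0; exact: (redexprP (r := [::]) _).2.
Qed.

Lemma sgen_neq1 i : sgen i != 1%g.
Proof.
apply/eqP => /permP/(_ (slo i)); rewrite sgen_lo perm1 => /(congr1 val) /=.
by move/eqP; rewrite eqn_leq ltnn.
Qed.

Lemma sgen_inj : injective (@sgen n).
Proof.
move=> i j ij; have hi : sgen j (slo i) = shi i by rewrite -ij sgen_lo.
apply: val_inj; have [e|ne] := eqVneq (slo i) (slo j).
  exact: (congr1 (@nat_of_ord n) e).
have [e|ne'] := eqVneq (slo i) (shi j).
  move: hi; rewrite {1}e sgen_hi => /(congr1 val) /= ji.
  by move/(congr1 val): e => /=; lia.
by move: hi; rewrite sgen_out // => /(congr1 val) /=; lia.
Qed.

(** A reduced word has length at most 1 here, and it is not empty because [sgen i] is not the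
    identity. *)
Lemma redexpr_sgen i : redexpr (sgen i) = [:: i].
Proof.
have [] := @redexprP (sgen i) [:: i] (mul1g _).
case: (redexpr _) => [/= e _|j [|//] /= e _].
  by have := sgen_neq1 i; rewrite -e eqxx.
by congr [:: _]; apply: sgen_inj; rewrite -e; exact/esym/mul1g.
Qed.
End SimpleTranspositions.

(** * Diagonal entries of the matrix isomorphism *)

Section Psi.
Variables (K : realType) (d n : nat) (xi : 'I_d -> K[i]) (mu : composition d n).
Variable Psi : yh K d n -> 'M[hecke K n]_(multinom mu).
Hypotheses (d_gt0 : (0 < d)%N) (xi_root : roots_of_unity xi).
Hypothesis PsiP : is_Psi xi Psi.
Local Notation Emu := (yEmu xi mu).
Implicit Types (x y : yh K d n) (b : base K).

Lemma Psi0 : Psi (Emu * 0) = 0.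
Proof.
have := psi_linear PsiP 1 0 0; rewrite scaler0 add0r.
have -> : map_mx (fun h : hecke K n => 1 *: h) (Psi (Emu * 0)) = Psi (Emu * 0).
  by apply/matrixP => p q; rewrite mxE scale1r.
by move/(congr1 (fun M => M - Psi (Emu * 0))); rewrite addrK subrr => ->.
Qed.

Lemma PsiZ b x : Psi (Emu * (b *: x)) = map_mx (fun h => b *: h) (Psi (Emu * x)).
Proof. by have := psi_linear PsiP b x 0; rewrite Psi0 !addr0. Qed.

(** The basis formula at w = 1, where the basis elements of both algebras reduce to 1. *)
Lemma Psi_yE (k : 'I_(multinom mu)) : Psi (yE xi (chik k)) = elem_mx k k 1.
Proof.
have e : char_act 1%g (chik k) = chik k.
  by apply/ffunP => j; rewrite ffunE invg1 perm1.
have := psi_basis PsiP e.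
have -> : Defs.pcomp (Defs.pcomp (mrep k)^-1%g 1%g) (mrep k) = 1%g.
  by rewrite /Defs.pcomp mul1g mulgV.
rewrite /yGt /hTt /plength redexpr1 !big_nil /=.
by rewrite (scale1r (1 : yh K d n)) mulr1 (scale1r (1 : hecke K n)).
Qed.

(** Multiplying by the elementary matrix at (k, k) on both sides isolates the diagonal entry, and
    this matrix is the image of the idempotent. *)
Lemma Psi_diag0 x (k : 'I_(multinom mu)) :
  yE xi (chik k) * x * yE xi (chik k) = 0 -> Psi (Emu * x) k k = 0.
Proof.
set E := yE xi _ => ExE.
have muE : Emu * E = E by apply: yEmu_yE => //; exact: has_comp_chik.
have Emu' : E * Emu = E by apply: yE_yEmu => //; exact: has_comp_chik.
have <- : (elem_mx k k 1 *m Psi (Emu * x) *m elem_mx k k 1) k k = Psi (Emu * x) k k.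
  have elemE p q : elem_mx k k (1 : hecke K n) p q = ((p == k) && (q == k))%:R.
    by rewrite mxE; case: ifP.
  rewrite mxE (bigD1 k) //= big1 => [|j ne]; last first.
    by rewrite elemE (negPf ne) mulr0.
  rewrite elemE !eqxx mulr1 addr0 mxE (bigD1 k) //= big1 => [|j ne]; last first.
    by rewrite elemE (negPf ne) andbF mul0r.
  by rewrite elemE !eqxx mul1r addr0.
(* The rules for [Psi] concern elements written [Emu * _], so [E] is replaced by [Emu * E] before
   they apply. *)
have h1 : Psi E *m Psi (Emu * x) = Psi (Emu * (E * x)).
  by rewrite -{1}muE -(psi_mul PsiP) muE !mulrA Emu' muE.
have h2 : Psi (Emu * (E * x)) *m Psi E = Psi (Emu * (E * x * E)).
  by rewrite -{2}muE -(psi_mul PsiP) muE !mulrA.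
by rewrite -Psi_yE -/E h1 h2 ExE Psi0 mxE.
Qed.
End Psi.

(** * Compositions (0, .., n, .., 0), for which the matrices have size 1 *)

Section Concentrated.
Variables (K : realType) (d n : nat) (xi : 'I_d -> K[i]) (mu : composition d n).
Variable a : 'I_d.
Hypotheses (d_gt0 : (0 < d)%N) (xi_root : roots_of_unity xi).
Hypothesis mu_a : forall b, part mu b = if b == a then n else 0%N.

Lemma multinom_concentrated : multinom mu = 1%N.
Proof.
rewrite /multinom (bigD1 a) //= mu_a eqxx big1 ?muln1 ?divnn ?fact_gt0 //.
by move=> b ne; rewrite mu_a (negPf ne).
Qed.

Lemma has_comp_concentrated chi : has_comp mu chi = (chi == [ffun=> a]).
Proof.
have cst chi' : has_comp mu chi' -> chi' = [ffun=> a].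
  move=> mchi; apply/ffunP => j; rewrite ffunE; have := has_comp_part j mchi.
  by rewrite mu_a; case: eqP.
apply/idP/eqP => [|->]; first exact: cst.
(* The size 1 provides an index [k]; [chik k] has composition [mu], hence is the constant
   character. *)
have k : 'I_(multinom mu) by rewrite multinom_concentrated; exact: ord0.
by rewrite -(cst _ (has_comp_chik k)) has_comp_chik.
Qed.

Lemma yEmu_concentrated : yEmu xi mu = yE xi [ffun=> a].
Proof.
by rewrite /yEmu (big_pred1 [ffun=> a]) // => chi; exact: has_comp_concentrated.
Qed.

Lemma chik_concentrated (k : 'I_(multinom mu)) : chik k = [ffun=> a].
Proof. by apply/eqP; rewrite -has_comp_concentrated has_comp_chik. Qed.

Lemma ord_multinom_concentrated :
  all_equal_to (cast_ord (esym multinom_concentrated) ord0).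
Proof.
by move=> k; apply: (can_inj (cast_ordK multinom_concentrated)); rewrite !ord1.
Qed.

(** The sole index is 0, where [mrep] lists the identity. *)
Lemma mrep_concentrated (k : 'I_(multinom mu)) : mrep k = 1%g.
Proof. by rewrite (ord_multinom_concentrated k). Qed.

Variable Psi : yh K d n -> 'M[hecke K n]_(multinom mu).
Hypothesis PsiP : is_Psi xi Psi.
Local Notation Emu := (yEmu xi mu).
Variable k : 'I_(multinom mu).

Lemma ord_multinom_eq (j : 'I_(multinom mu)) : j = k.
Proof. by rewrite (ord_multinom_concentrated j) (ord_multinom_concentrated k). Qed.

Lemma Psi_yG i : Psi (Emu * yG K d i) k k = hT K i.
Proof.
have e : char_act (sgen i) (chik k) = chik k.
  by rewrite chik_concentrated; apply/ffunP => j; rewrite !ffunE.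
have := psi_basis PsiP e.
rewrite mrep_concentrated invg1 /Defs.pcomp !(mul1g, mulg1).
rewrite /yGt /hTt /plength redexpr_sgen !big_seq1 /= chik_concentrated.
rewrite -yEmu_concentrated (PsiZ PsiP) => /matrixP/(_ k k).
(* Both normalised generators carry the factor u^-1 of a word of length one; multiplying by u
   cancels it. *)
rewrite !mxE eqxx /= => /(congr1 (fun h => upow K 1 *: h)).
rewrite !scalerA -upowD subrr upow0.
by rewrite (scale1r (hT K i)) (scale1r (Psi (Emu * yG K d i) k k)).
Qed.

(** Since e_i is absorbed by the idempotent, the inverse u^-2 (g_i - v e_i) becomes u^-2 (g_i - v),
    which has the shape of T_i^-1. *)
Lemma Psi_yGV i : Psi (Emu * yGV K d i) k k = hTV K i.
Proof.
have -> : Emu * yGV K d i =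
    Emu * (upow K (-2) *: (- vvar K *: (1 : yh K d n) + yG K d i)).
  rewrite yEmu_concentrated /yGV -!pscaleAr mulrBr mulrDr; congr (_ *: _).
  rewrite -[X in _ - X]pscaleAr yE_const_ye // -pscaleAr mulr1.
  by rewrite scaleNr addrC.
rewrite (PsiZ PsiP) mxE (psi_linear PsiP) !mxE mulr1 (psi_one PsiP) Psi_yG.
by rewrite mxE eqxx scaleNr addrC.
Qed.

Lemma PsiM x y : Emu * x = x * Emu ->
  Psi (Emu * (x * y)) k k = Psi (Emu * x) k k * Psi (Emu * y) k k.
Proof.
move=> xE; have -> : Emu * (x * y) = Emu * x * (Emu * y).
  rewrite -mulrA [x * (_ * _)]mulrA -xE !mulrA yEmu_concentrated.
  by rewrite yE_idem.
rewrite (psi_mul PsiP) mxE (big_pred1 k) // => j.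
by rewrite (ord_multinom_eq j) /= eqxx.
Qed.

Lemma Psi_weval (w : seq (letter n)) :
  Psi (Emu * weval (@yG K d n) (@yGV K d n) w) k k = weval (@hT K n) (@hTV K n) w.
Proof.
rewrite /weval; elim: w => [|[i b] w IH].
  by rewrite !big_nil mulr1 (psi_one PsiP) mxE eqxx.
rewrite !big_cons PsiM; last first.
  by rewrite yEmu_concentrated; case: b; [exact: yE_const_yG | exact: yE_const_yGV].
by rewrite IH; case: b; rewrite ?Psi_yG ?Psi_yGV.
Qed.

Lemma mxtrace_concentrated (M : 'M[hecke K n]_(multinom mu)) : \tr M = M k k.
Proof.
by rewrite /mxtrace (big_pred1 k) // => j; rewrite (ord_multinom_eq j) /= eqxx.
Qed.

Lemma offset_concentrated : offset mu a = 0%N.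
Proof.
by apply: big1 => b ba; rewrite mu_a; case: eqP ba => // ->; rewrite ltnn.
Qed.

End Concentrated.

(** * The tensor product of traces when only one block is nonempty *)

Section TensorTrace.
Variables (K : realType) (d n : nat) (mu : composition d n) (a : 'I_d).
Hypothesis mu_a : forall b, part mu b = if b == a then n else 0%N.
Variables (tau : forall n : nat, hecke K n -> base K) (f : hecke K n -> base K).
Hypothesis tauP : markov_family tau.
Hypothesis fP : tensor_trace mu tau f.

Lemma block_gen_far b (i j : 'I_(part mu b).-1) :
  far i j -> far (block_gen i) (block_gen j).
Proof. by rewrite /far /=; lia. Qed.
Lemma block_gen_adj b (i j : 'I_(part mu b).-1) :
  Defs.adjacent i j -> Defs.adjacent (block_gen i) (block_gen j).
Proof. by rewrite /Defs.adjacent /=; lia. Qed.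

Lemma block_emb1 b : block_emb (1 : hecke K (part mu b)) = 1.
Proof.
have := hecke_map_const (@block_gen_far b) (@block_gen_adj b) (1 : base K).
by rewrite (scale1r (1 : hecke K (part mu b))) (scale1r (1 : hecke K n)).
Qed.

Lemma block_emb_hTV b (i : 'I_(part mu b).-1) :
  block_emb (hTV K i) = hTV K (block_gen i).
Proof.
have far_b := @block_gen_far b; have adj_b := @block_gen_adj b.
have e : block_emb (hTV K i) * hT K (block_gen i) = 1.
  rewrite -(block_emb1 b) -(hTV_hT K i) [RHS]hecke_mapM //; congr (_ * _).
  by rewrite hecke_map_gen.
by rewrite -[LHS]mulr1 -(hT_hTV K (block_gen i)) mulrA e mul1r.
Qed.

Lemma block_emb_weval b (w : seq (letter (part mu b))) :
  block_emb (weval (@hT K _) (@hTV K _) w) =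
  weval (@hT K _) (@hTV K _) [seq (block_gen l.1, l.2) | l <- w].
Proof.
have far_b := @block_gen_far b; have adj_b := @block_gen_adj b.
rewrite /weval; elim: w => [|[i s] w IH] /=; first by rewrite !big_nil block_emb1.
rewrite !big_cons -IH [LHS]hecke_mapM //; congr (_ * _).
by case: s; [exact: hecke_map_gen | exact: block_emb_hTV].
Qed.

Lemma tau0_1 : tau (1 : hecke K 0) = 1.
Proof. by rewrite -[in RHS](mf_zero tauP 1) (scale1r (1 : hecke K 0)). Qed.

(** [part mu a] equals n only propositionally, so words are transported between the two types with
    their numerical indices unchanged. *)
Lemma weval_cast m (e : m = n) (w : seq (letter n)) :
  exists2 w' : seq (letter m),
    tau (weval (@hT K m) (@hTV K m) w') = tau (weval (@hT K n) (@hTV K n) w) &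
    [seq (nat_of_ord l.1, l.2) | l <- w']
    = [seq (nat_of_ord l.1, l.2) | l <- w].
Proof. by move: w; case: n / e => w; exists w. Qed.

(** [f] is prescribed on products of block embeddings. The word is such a product, with 1 in each
    empty block, where tau_0(1) = 1. *)
Lemma tensor_trace_weval (w : seq (letter n)) :
  f (weval (@hT K n) (@hTV K n) w) = tau (weval (@hT K n) (@hTV K n) w).
Proof.
set W := weval _ _ w.
have P b : exists x : hecke K (part mu b),
    block_emb x = (if b == a then W else 1) /\
    tau x = (if b == a then tau W else 1).
  have [->|ne] := eqVneq b a; last first.
    exists 1; rewrite block_emb1; split=> //.
    have e : part mu b = 0%N by rewrite mu_a (negPf ne).
    by rewrite e tau0_1.
  have e : part mu a = n by rewrite mu_a eqxx.
  have [w' tauw w'w] := weval_cast e w.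
  exists (weval (@hT K _) (@hTV K _) w'); split; last exact: tauw.
  rewrite block_emb_weval /W; congr weval.
  apply: (@inj_map _ _ (fun l : letter n => (nat_of_ord l.1, l.2))).
    by move=> [i s] [j s'] /= [/val_inj -> ->].
  (* All blocks before [a] are empty, so the embedding of this block does not shift indices. *)
  rewrite -w'w -map_comp; apply: eq_map => l /=.
  by rewrite offset_concentrated.
pose x b := projT1 (cid (P b)).
have xE b : block_emb (x b) = if b == a then W else 1 := (projT2 (cid (P b))).1.
have xT b : tau (x b) = if b == a then tau W else 1 :=
  (projT2 (cid (P b))).2.
have := fP.2 x; rewrite (eq_bigr _ (fun b _ => xE b)) (eq_bigr _ (fun b _ => xT b)).
by rewrite -!big_mkcond !big_pred1_eq.
Qed.
End TensorTrace.

(** * Supports of compositions *)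

Section Compositions0.
Variables (d n : nat) (mu0 : composition0 d).

Lemma weight0_eq1 : weight0 mu0 = 1%N ->
  exists a, forall b, val mu0 b = (b == a).
Proof.
have /existsP[a m0a] := valP mu0; rewrite /weight0 (bigD1 a) //= m0a.
move=> [] /eqP; rewrite sum_nat_eq0 => /forall_inP m0; exists a => b.
by have [->//|/m0] := eqVneq b a; rewrite eqb0 => /negPf.
Qed.

Lemma weight0_neq1 : weight0 mu0 != 1%N ->
  exists a b, [/\ a != b, val mu0 a & val mu0 b].
Proof.
have /existsP[a m0a] := valP mu0; rewrite /weight0 (bigD1 a) //= m0a.
rewrite eqSS sum_nat_eq0 => /forall_inPn[b ba]; rewrite eqb0 negbK => m0b.
by exists a, b; rewrite eq_sym.
Qed.

Lemma comp_supp_concentrated a : (0 < n)%N -> (forall b, val mu0 b = (b == a)) ->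
  exists2 mu : composition d n,
    (forall mu', comp_supp mu' mu0 = (mu' == mu)) &
    forall b, part mu b = if b == a then n else 0%N.
Proof.
move=> n_gt0 m0.
have supp (mu : composition d n) : comp_supp mu mu0 -> forall b,
      part mu b = if b == a then n else 0%N.
  move=> /forallP mu_m0.
  have mu_ne b : b != a -> part mu b = 0%N.
    by move=> ba; move/eqP: (mu_m0 b); rewrite m0 (negPf ba) lt0n => /negbFE/eqP.
  move=> b; have [->|/mu_ne //] := eqVneq b a.
  by rewrite -[RHS](sum_part mu) (bigD1 a) //= big1 ?addn0.
pose F : {ffun 'I_d -> 'I_n.+1} := [ffun b => if b == a then ord_max else ord0].
have FE b : F b = (if b == a then n else 0%N) :> nat by rewrite ffunE; case: ifP.
have F_n : (\sum_b F b == n)%N.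
  rewrite (bigD1 a) //= FE eqxx big1 ?addn0 // => b ba.
  by rewrite FE (negPf ba).
exists (exist _ F F_n); last exact: FE.
move=> mu; apply/idP/eqP => [/supp e|->].
  by apply/val_inj/ffunP => b; apply: val_inj; rewrite /= FE -e.
by apply/forallP => b; rewrite m0 /part /= FE; case: (b == a); rewrite ?n_gt0.
Qed.
End Compositions0.

(** * The basic invariants of a one-component closure *)

Section Knots.
Variables (K : realType) (d : nat) (xi : 'I_d -> K[i]).
Variable tau : forall n : nat, hecke K n -> base K.
Variable tau_mu : forall (n : nat) (mu : composition d n), hecke K n -> base K.
Variable Psi : forall (n : nat) (mu : composition d n),
  yh K d n -> 'M[hecke K n]_(multinom mu).
Hypotheses (d_gt0 : (0 < d)%N) (xi_root : roots_of_unity xi).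
Hypothesis tauP : markov_family tau.
Hypothesis tau_muP :
  forall n (mu : composition d n), tensor_trace mu tau (@tau_mu n mu).
Hypothesis PsiP : forall n (mu : composition d n), is_Psi xi (@Psi n mu).

(** Linearity is given on H^mu, so 0 is first shown to lie there. *)
Lemma tau_mu0 n (mu : composition d n) : tau_mu mu 0 = 0.
Proof.
have H0 : in_young_hecke mu (0 : hecke K n).
  by have := iyh_const mu (0 : base K); rewrite (scale0r (1 : hecke K n)).
have := (tau_muP mu).1 1 0 0 H0 H0; rewrite scaler0 addr0 mul1r => e.
by apply: (addrI (tau_mu mu 0)); rewrite -e addr0.
Qed.

Lemma rho0 n (m : composition0 d) : rho xi tau_mu Psi m (0 : yh K d n) = 0.
Proof.
by apply: big1 => mu _; rewrite (Psi0 (PsiP mu)) mxtrace0 tau_mu0.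
Qed.

Lemma Gamma_yh_knot n (w : seq (letter n)) (mu0 : composition0 d) :
  #|closure_comp w| = 1%N ->
  Gamma_yh xi tau_mu Psi mu0 (braid_of w) =
    if weight0 mu0 == 1%N then lconst (Gamma_hecke tau (braid_of w)) else 0.
Proof.
move=> w1; apply: laurentP => k; rewrite lcoef_lmap ?rho0 //.
have -> : delta_yh K d (braid_of w) = weval (@delta_gen K d n) (@delta_genV K d n) w.
  exact: (beval_of (delta_gen_genV K d_gt0) (delta_genV_gen K d_gt0)
    (delta_gen_far K d_gt0) (delta_gen_braid K d_gt0)).
rewrite /rho.
case: ifPn => [/eqP/weight0_eq1[a m0]|/weight0_neq1[a [b [ab m0a m0b]]]].
  have [mu mu_supp mu_a] := comp_supp_concentrated (closure_comp1_gt0 w1) m0.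
  rewrite (big_pred1 mu) //.
  have k0 : 'I_(multinom mu) by rewrite (multinom_concentrated mu_a); exact: ord0.
  rewrite (mxtrace_concentrated mu_a k0).
  (* For the constant character the image of the braid is free of gamma, so only the coefficient at
     k = 0 survives. *)
  have -> : yEmu xi mu * lcoef (weval (@delta_gen K d n) (@delta_genV K d n) w) k =
      yEmu xi mu * (if k == 0 then weval (@yG K d n) (@yGV K d n) w else 0).
    rewrite (yEmu_concentrated xi mu_a) -[k in lcoef _ k]subr0 -lcoef_monoM.
    rewrite -/(lconst _) [lmul _ _]yE_const_delta_yh // lcoef_mono.
    by case: ifP; rewrite ?mulr0.
  rewrite lcoef_mono; case: ifP => _; last by rewrite (Psi0 (PsiP mu)) mxE tau_mu0.
  rewrite (Psi_weval d_gt0 xi_root mu_a (PsiP mu)).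
  rewrite (tensor_trace_weval mu_a tauP (tau_muP mu)) /Gamma_hecke; congr tau.
  exact/esym/(beval_of (@hT_hTV K n) (@hTV_hT K n) (@hT_far K n) (@hT_braid K n)).
rewrite lcoef0; apply: big1 => mu /forallP mu_m0.
rewrite /mxtrace big1 ?tau_mu0 // => q _.
apply: (Psi_diag0 d_gt0 xi_root (PsiP mu)).
(* If [chik q] were invariant under the cycle it would be constant, yet it takes both values [a] and
   [b], whose parts in [mu] are nonzero. *)
have [p ne] : exists p, chik q (bperm w p) != chik q p.
  apply/existsP; rewrite -negb_forall; apply/negP => /forallP inv.
  have cst := closure_comp1_const w1 (fun p => eqP (inv p)).
  have onto c : val mu0 c -> exists p, chik q p = c.
    rewrite -(eqP (mu_m0 c)) => /chi1_onto[j <-].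
    by exists (mrep q j); rewrite ffunE permK.
  have [[p pa] [p' pb]] := (onto a m0a, onto b m0b).
  by move: ab; rewrite -pa -pb (cst p p') eqxx.
exact: (yE_delta_yh_yE _ _ _ ne).
Qed.
End Knots.

Theorem proposition6p8 (K : realType) (d : nat) (xi : 'I_d -> K[i])
    (tau : forall n : nat, hecke K n -> base K)
    (tau_mu : forall (n : nat) (mu : composition d n), hecke K n -> base K)
    (Psi : forall (n : nat) (mu : composition d n),
      yh K d n -> 'M[hecke K n]_(multinom mu)) :
  (0 < d)%N ->
  roots_of_unity xi ->
  markov_family tau ->
  (forall (n : nat) (mu : composition d n), tensor_trace mu tau (tau_mu n mu)) ->
  (forall (n : nat) (mu : composition d n), is_Psi xi (Psi n mu)) ->
  (forall (L : link K) (n : nat) (beta : braid n) (mu0 : composition0 d),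
     is_knot L -> closure_of beta L ->
     Gamma_yh xi tau_mu Psi mu0 beta =
       if weight0 mu0 == 1%N then lconst (Gamma_hecke tau beta) else 0)
  /\
  (forall (L1 L2 : link K) (n1 n2 : nat) (beta1 : braid n1) (beta2 : braid n2),
     is_knot L1 -> is_knot L2 -> closure_of beta1 L1 -> closure_of beta2 L2 ->
     ((forall mu0 : composition0 d,
         Gamma_yh xi tau_mu Psi mu0 beta1 = Gamma_yh xi tau_mu Psi mu0 beta2)
      <-> Gamma_hecke tau beta1 = Gamma_hecke tau beta2)).
Proof.
move=> d_gt0 xi_root tauP tau_muP PsiP.
have knot (L : link K) n (beta : braid n) (mu0 : composition0 d) :
    is_knot L -> closure_of beta L ->
    Gamma_yh xi tau_mu Psi mu0 beta =
      if weight0 mu0 == 1%N then lconst (Gamma_hecke tau beta) else 0.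
  by move=> L1 /(closure_of_knot L1)[w <- w1]; exact: Gamma_yh_knot.
split=> // L1 L2 n1 n2 beta1 beta2 k1 k2 c1 c2; split=> [e|e mu0]; last first.
  by rewrite (knot _ _ _ _ k1 c1) (knot _ _ _ _ k2 c2) e.
(* A single tuple of weight 1 suffices to recover the HOMFLYPT polynomial; since d > 0, its entry 1
   can be put at the first index. *)
pose a := Ordinal d_gt0; pose m : {ffun 'I_d -> bool} := [ffun b => b == a].
have m_a : [exists b, m b] by apply/existsP; exists a; rewrite ffunE eqxx.
have := e (exist _ m m_a); rewrite (knot _ _ _ _ k1 c1) (knot _ _ _ _ k2 c2).
have -> : weight0 (exist _ m m_a) = 1%N.
  rewrite /weight0 (bigD1 a) //= ffunE eqxx big1 // => b ba.
  by rewrite ffunE (negPf ba).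
by rewrite eqxx => /lconst_inj.
Qed.
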